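(* Let $n$ be a positive integer. Let $\mathscr{T}_n(x,y,(z_I)_{\varnothing\ne I\subseteq[n]})$ be the universal Tutte polynomial and let $\widehat{\mathscr{T}}_n(x,y,(t_I)_{\varnothing\ne I\subseteq[n]})$ be the polynomial obtained from $\mathscr{T}_n$ by the substitution $$z_I=\sum_{\varnothing\ne J\subseteq[n],\ J\cap I\ne\varnothing}t_J .$$ Then $$\widehat{\mathscr{T}}_n(x,y,(t_I))=(x+y-1)\sum_{B\in\mathcal{B}_n}(-1)^{\ell(B)-1}\,D_n((t^B_I))\,x^{\mathrm{lr}(B)-1}\,y^{\mathrm{rl}(B)-1},$$ where $\mathcal{B}_n$ is the set of ordered set partitions of $[n]$; $D_n$ is the $n$-th dragon polynomial; $\ell(B)$ is the number of blocks of $B$; $\mathrm{lr}(B)$ and $\mathrm{rl}(B)$ are the numbers of left-to-right and right-to-left minima of $B$, respectively; and, for any $B=(B_1,\ldots,B_\ell)\in\mathcal{B}_n$ and any nonempty $I\subseteq[n]$, $$t^B_I=\sum_{J\subseteq\bigcup_{i<k}B_i}t_{I\cup J}$$ if $I\subseteq B_k$ for some $k\in[\ell]$, and $t^B_I=0$ if $I$ is contained in none of the blocks $B_k$. Moreover, $\mathscr{T}_n(x,y,(z_I))$ is obtained from $\widehat{\mathscr{T}}_n(x,y,(t_I))$ by the substitution $$t_I=\sum_{\varnothing\ne J\subseteq[n],\ J\cup I=[n]}(-1)^{|I\cap J|+1}z_J.$$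
   Context: Notation: $[n]=\{1,\dots,n\}$; $\mathbf e_1,\dots,\mathbf e_n$ is the canonical basis of $\mathbb{R}^n$. Ordered set partitions: tuples $B=(B_1,\ldots,B_\ell)$ of nonempty disjoint subsets of $[n]$ with union $[n]$. A left-to-right minimum (resp. right-to-left minimum) of $B$ is an integer $m\in[n]$ such that $m=\min(\bigcup_{i\le k}B_i)$ (resp. $m=\min(\bigcup_{i\ge k}B_i)$) for some $k\in[\ell]$. Dragon polynomial: a function $g:2^{[n]}\setminus\{\varnothing\}\to\mathbb{Z}_{\ge0}$ is $n$-draconian if $\sum_I g(I)=n-1$ and for any $k>0$ and any distinct nonempty subsets $I_1,\dots,I_k$ of $[n]$, $\sum_{j=1}^kg(I_j)\le|\bigcup_{j=1}^kI_j|-1$. Then $$D_n((t_I))=\sum_{g\ n\text{-draconian}}\binom{t_{[n]}-1}{g([n])}\prod_{\varnothing\ne I\subsetneq[n]}\binom{t_I}{g(I)},$$ where $\binom tk=\frac1{k!}t(t-1)\cdots(t-k+1)$, $\binom t0=1$. The universal Tutte polynomial $\mathscr{T}_n(x,y,(z_I))$ is the unique polynomial (with rational coefficients) in $x,y$ and variables $z_I$ ($\varnothing\ne I\subseteq[n]$) such that for every submodular function $f:2^{[n]}\to\mathbb{Z}$, substituting $z_I=f(I)$ for all $I$ gives $\mathscr{T}_{P_f}(x,y)$ (existence and uniqueness are known). Here $f:2^{[n]}\to\mathbb{Z}$ is submodular if $f(\varnothing)=0$ and $f(I)+f(J)\ge f(I\cup J)+f(I\cap J)$ for all $I,J$, and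 $$P_f=\Big\{\mathbf x\in\mathbb{Z}^n\ \Big|\ \sum_{i\in I}x_i\le f(I)\ \text{for all } I\subseteq[n],\ \text{and}\ \sum_{i\in[n]}x_i=f([n])\Big\}.$$ For $P=P_f$ and $\mathbf a\in P$, an index $i\in[n]$ is internally active if there is no $j<i$ with $\mathbf a-\mathbf e_i+\mathbf e_j\in P$, and externally active if there is no $j<i$ with $\mathbf a+\mathbf e_i-\mathbf e_j\in P$; $\mathrm{Int}(\mathbf a),\mathrm{Ext}(\mathbf a)$ are the sets of such indices, and $$\mathscr{T}_P(x,y)=\sum_{\mathbf a\in P}x^{|\mathrm{Int}(\mathbf a)\setminus\mathrm{Ext}(\mathbf a)|}\,y^{|\mathrm{Ext}(\mathbf a)\setminus\mathrm{Int}(\mathbf a)|}\,(x+y-1)^{|\mathrm{Int}(\mathbf a)\cap\mathrm{Ext}(\mathbf a)|}.$$ *)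

(* Defs.v *)
From HB Require Import structures.
From mathcomp Require Import boolp classical_sets functions cardinality fsbigop.
From mathcomp Require Import all_boot all_order all_algebra.
From mathcomp Require Import mpoly.
Set Implicit Arguments.
Unset Strict Implicit.
Unset Printing Implicit Defensive.
Import Order.TTheory GRing.Theory Num.Theory.
Local Open Scope ring_scope.

(* The ground set [n] = {1, ..., n} is 'I_n, with its usual order. *)

Definition neset (n : nat) := {I : {set 'I_n} | I != set0}.

(* Indexes the variable t_(I :|: J), with no junk variable for the empty set. *)
Fact neset_unionP n (I : neset n) (J : {set 'I_n}) :
  val I :|: J != set0.
Proof.
apply: contra (valP I) => /eqP e; rewrite -subset0.
by apply: (subset_trans (subsetUl _ J)); rewrite e.
Qed.

Definition neset_union n (I : neset n) (J : {set 'I_n}) : neset n :=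
  Sub (val I :|: J) (neset_unionP I J).

Definition submodular n (f : {set 'I_n} -> int) : Prop :=
  f set0 = 0 /\
  forall I J : {set 'I_n}, f (I :|: J) + f (I :&: J) <= f I + f J.

Definition base_points n (f : {set 'I_n} -> int) : pred 'rV[int]_n :=
  fun a => [forall I : {set 'I_n}, \sum_(i in I) a 0 i <= f I] &&
           (\sum_i a 0 i == f [set: 'I_n]).

Section Activities.
Variables (n : nat) (P : pred 'rV[int]_n).

Definition basis_vec (i : 'I_n) : 'rV[int]_n := delta_mx 0 i.

Definition int_active (a : 'rV[int]_n) : {set 'I_n} :=
  [set i : 'I_n | ~~ [exists j : 'I_n,
                 (j < i)%N && P (a - basis_vec i + basis_vec j)]].

Definition ext_active (a : 'rV[int]_n) : {set 'I_n} :=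
  [set i : 'I_n | ~~ [exists j : 'I_n,
                 (j < i)%N && P (a + basis_vec i - basis_vec j)]].

(* T_P(x, y) for finite P.  The sum over the set P is the finitely supported
   one of fsbigop, so it is meaningful only for finite P: see
   finite_base_points. *)
Definition tutte (R : comNzRingType) (x y : R) : R :=
  \sum_(a \in [set a | P a]%classic)
     x ^+ #|int_active a :\: ext_active a| *
     y ^+ #|ext_active a :\: int_active a| *
     (x + y - 1) ^+ #|int_active a :&: ext_active a|.

End Activities.

Lemma finite_base_points n (f : {set 'I_n} -> int) :
  finite_set [set a | base_points f a]%classic.
Proof.
pose lo i := f [set: 'I_n] - f (~: [set i]).
pose M := (\sum_i `|f [set i] - lo i|)%N.
pose h (g : {ffun 'I_n -> 'I_M.+1}) : 'rV[int]_n := \row_i (lo i + (g i)%:Z).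
apply: (@sub_finite_set _ _ (range h)); last first.
  by apply: finite_image; exact: cardinality.finite_finset.
move=> a /= /andP[/forallP af /eqP aT].
have hi i : a 0 i <= f [set i] by have := af [set i]; rewrite big_set1.
have low i : lo i <= a 0 i.
  rewrite /lo -aT (bigD1 i) //= lerBlDr lerD2l.
  have := af (~: [set i]); congr (_ <= _).
  by apply: eq_bigl => j; rewrite !inE.
have bnd i : (`|(a 0 i - lo i)%R| < M.+1)%N.
  rewrite ltnS /M (bigD1 i) //=; apply: leq_trans (leq_addr _ _).
  rewrite -lez_nat !gez0_abs ?subr_ge0 ?lerD2r //.
  exact: le_trans (low i) (hi i).
exists [ffun i => Ordinal (bnd i)] => //.
apply/rowP => i; rewrite mxE ffunE /= gez0_abs ?subr_ge0 //.
by rewrite addrC subrK.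
Qed.

(* Polynomials in x = inl 0, y = inl 1 and one variable inr I for each nonempty
   subset I of [n]; the last ones are the z_I or the t_I. *)
Notation tutte_var n := ('I_2 + neset n)%type.
Notation tutte_ring n := {mpoly rat[#|{: tutte_var n}|]}.

Definition pvar (V : finType) (v : V) : {mpoly rat[#|V|]} := 'X_(enum_rank v).

Definition psubst (V : finType) (k : nat) (s : V -> {mpoly rat[k]})
    (p : {mpoly rat[#|V|]}) : {mpoly rat[k]} :=
  p \mPo [tuple s (enum_val i) | i < #|V|].

Definition xvar n : tutte_ring n := pvar (inl 0 : tutte_var n).
Definition yvar n : tutte_ring n := pvar (inl 1 : tutte_var n).
Definition svar n (I : neset n) : tutte_ring n := pvar (inr I : tutte_var n).

Definition set_subst n (s : neset n -> tutte_ring n) (p : tutte_ring n) :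
    tutte_ring n :=
  psubst (fun v : tutte_var n =>
            match v with inl i => pvar (inl i : tutte_var n) | inr A => s A end)
         p.

(* The substitution z_I = f(I); the result is a polynomial in x and y. *)
Definition specialize n (f : {set 'I_n} -> int) (p : tutte_ring n) :
    {mpoly rat[2]} :=
  psubst (fun v : tutte_var n =>
            match v with inl i => 'X_i | inr A => (f (val A))%:~R end)
         p.

Definition universal_tutte n (T : tutte_ring n) : Prop :=
  forall f : {set 'I_n} -> int, submodular f ->
    specialize f T = tutte (base_points f) 'X_0 'X_1.

Definition z_of_t n (I : neset n) : tutte_ring n :=
  \sum_(J : neset n | val J :&: val I != set0) svar J.

Definition t_of_z n (I : neset n) : tutte_ring n :=
  \sum_(J : neset n | val J :|: val I == [set: 'I_n])
     (-1) ^+ (#|val I :&: val J| + 1) * svar J.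

Definition draconian n (g : neset n -> nat) : bool :=
  (\sum_(I : neset n) g I == n - 1)%N &&
  [forall S : {set neset n}, (S != set0) ==>
     (\sum_(I in S) g I <= #|\bigcup_(I in S) val I| - 1)%N].

Definition gbinom (R : algType rat) (t : R) (k : nat) : R :=
  (k`!%:R^-1 : rat) *: \prod_(i < k) (t - i%:R).

(* D_n((t_I)) for n > 0.  A draconian function has total n - 1, hence takes
   values in 'I_n.  The first product has a single factor, I = [n]. *)
Definition dragon n (R : algType rat) (t : neset n -> R) : R :=
  \sum_(g : {ffun neset n -> 'I_n} | draconian (fun I => g I))
     (\prod_(I : neset n | val I == [set: 'I_n]) gbinom (t I - 1) (g I)) *
     (\prod_(I : neset n | val I != [set: 'I_n]) gbinom (t I) (g I)).

Section OrderedSetPartitions.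
Variables (n l : nat) (B : l.-tuple {set 'I_n}).

Definition ord_set_partition : bool :=
  [&& [forall k, tnth B k != set0],
      [forall j, forall k, (j != k) ==> [disjoint tnth B j & tnth B k]] &
      \bigcup_(k < l) tnth B k == [set: 'I_n]].

Definition is_min (A : {set 'I_n}) (m : 'I_n) : bool :=
  (m \in A) && [forall j in A, (m <= j)%N].

Definition lr_min : nat :=
  #|[set m : 'I_n | [exists k : 'I_l, is_min (\bigcup_(i < l | (i <= k)%N) tnth B i) m]]|.

Definition rl_min : nat :=
  #|[set m : 'I_n | [exists k : 'I_l, is_min (\bigcup_(i < l | (k <= i)%N) tnth B i) m]]|.

(* t^B; when B is an ordered set partition the index k is unique. *)
Definition block_param (R : nmodType) (t : neset n -> R) (I : neset n) : R :=
  if [pick k : 'I_l | val I \subset tnth B k] is Some k then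
    \sum_(J : {set 'I_n} | J \subset \bigcup_(i < l | (i < k)%N) tnth B i)
       t (neset_union I J)
  else 0.

End OrderedSetPartitions.

(* Main.v *)
Require Import Defs.
From HB Require Import structures.
From mathcomp Require Import boolp classical_sets cardinality fsbigop.
From mathcomp Require Import all_boot all_order all_algebra.
From mathcomp Require Import mpoly zify ring lra.
Set Implicit Arguments.
Unset Strict Implicit.
Unset Printing Implicit Defensive.
Import Order.TTheory GRing.Theory Num.Theory.
Local Open Scope ring_scope.

(** Let t be a family of positive integers and f(A) the sum of the t_J over the J
    meeting A.  Then P_f consists of the lattice points of the Minkowski sum of
    the simplices on the sets J, taken with multiplicities t_J.  Since every pair
    of indices is one of the J, the tight sets of a point form a chain, that is,
    the point lies in the relative interior of the face given by one ordered set
    partition B.  The tight sets decide which unit exchanges stay inside P_f, so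
    all points of this face have the activities read off from B, and each of them
    contributes (x + y - 1) x^(lr - 1) y^(rl - 1) (tutte_generic).  It remains to
    count the relative interior points of the faces.

    The face of B is itself a sum of simplices, with multiplicities t^B.  At
    x = y = 0 the Tutte polynomial of such a sum keeps only the points with equal
    internal and external activities.  These are the points whose exchange
    relation is symmetric (label_min_sym), hence the relative interior points,
    each with sign (-1)^l where l is the number of blocks (tutte00, cell_face).
    So the number wanted is (-1)^l times the value at (0, 0, t^B) of the
    transformed universal polynomial, and the theorem reduces to the identity
    that its value at (0, 0, t) is - D_n(t) (tutte_zero_dragon).

    For this identity universality is used once more: it says that the left side
    is a polynomial in t.  When t_[n] >= 1 it is minus a number of interior
    points, which is O(|t|^(n-1)) because one of the n coordinates is determined
    by the others.  So both sides have degree at most n - 1, and they need only be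
    compared when t_[n] = 1 + h_[n] and t_I = h_I otherwise, with h of total at most
    n - 1.  An interior point has positive coordinates with sum 1 + |h| <= n; hence
    it is the all-ones vector, and this vector is interior exactly when h is
    draconian (interior_count_small).  On the other side, the product of the
    binomials of h_I over g(I) vanishes unless g <= h, that is g = h, so that
    D_n(t) is also 1 or 0 according to whether h is draconian (dragon_small).

    Everything is an identity between values at positive integers, which is
    enough by Zariski density (mpoly_nat_eq0).  The last assertion is an
    inclusion-exclusion formula (inclusion_exclusion). *)

(** * Polynomials and polynomial functions on natural points *)

Lemma poly_nat_eq0 (u : {poly rat}) :
  (forall k : nat, u.[k.+1%:R] = 0) -> u = 0.
Proof.
move=> u0; apply/eqP; apply: contraT => u_neq0.
pose rs := [seq (k.+1%:R : rat) | k <- iota 0 (size u)].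
have : (size rs < size u)%N.
  apply: max_poly_roots => //.
    by apply/allP => _ /mapP[k _ ->]; rewrite rootE u0.
  by rewrite map_inj_uniq ?iota_uniq // => i j /eqP; rewrite eqr_nat eqSS => /eqP.
by rewrite size_map size_iota ltnn.
Qed.

Lemma digits_inj (B n : nat) (c d : 'I_n -> nat) :
  (forall i, c i < B)%N -> (forall i, d i < B)%N ->
  (\sum_i c i * B ^ i = \sum_i d i * B ^ i)%N -> c =1 d.
Proof.
elim: n c d => [|n IHn] c d cB dB; first by move=> _ [].
have B_gt0 : (0 < B)%N by apply: leq_ltn_trans (cB ord0).
have shift (e : 'I_n.+1 -> nat) :
    (\sum_i e i * B ^ i = (\sum_(i < n) e (lift ord0 i) * B ^ i) * B + e ord0)%N.
  rewrite big_ord_recl /= muln1 addnC big_distrl /=; congr (_ + _)%N.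
  by apply: eq_bigr => i _; rewrite -mulnA -expnSr.
rewrite !shift => e.
have e0 : c ord0 = d ord0.
  by have := congr1 (modn^~ B) e; rewrite !modnMDl !modn_small.
have /IHn eS : (\sum_(i < n) c (lift ord0 i) * B ^ i =
                \sum_(i < n) d (lift ord0 i) * B ^ i)%N.
  by have := congr1 (divn^~ B) e; rewrite !divnMDl // !divn_small // !addn0.
move=> i; case: (unliftP ord0 i) => [j ->|-> //].
by apply: eS => k.
Qed.

(** Along the Kronecker curve k |-> (k ^ (B ^ i))_i, with B above the degree,
    distinct monomials restrict to distinct powers of k; so the coefficients of p
    are those of a univariate polynomial vanishing at all positive integers. *)
Lemma mpoly_nat_eq0 (m : nat) (p : {mpoly rat[m]}) :
  (forall w : 'I_m -> nat, p.@[fun i => (w i).+1%:R] = 0) -> p = 0.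
Proof.
move=> p0; pose B := msize p.
pose code (mu : 'X_{1..m}) := (\sum_i mu i * B ^ i)%N.
pose u : {poly rat} := \sum_(mu <- msupp p) p@_mu *: 'X^(code mu).
have u0 : u = 0.
  apply: poly_nat_eq0 => k; rewrite -(p0 (fun i : 'I_m => (k.+1 ^ B ^ i).-1)%N).
  rewrite mevalE horner_sum; apply: eq_bigr => mu _.
  rewrite hornerZ hornerXn -prodrXr; congr (_ * _); apply: eq_bigr => i _.
  by rewrite prednK ?expn_gt0 // natrX -exprM mulnC.
apply/mpolyP => mu; rewrite mcoeff0.
case: (boolP (mu \in msupp p)) => [mu_p|/memN_msupp_eq0 //].
have digit (nu : 'X_{1..m}) (i : 'I_m) : nu \in msupp p -> (nu i < B)%N.
  move/msize_mdeg_lt; apply: leq_ltn_trans.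
  by rewrite mdegE (bigD1 i) //= leq_addr.
have := congr1 (fun q : {poly rat} => q`_(code mu)) u0.
rewrite coef0 coef_sum (bigD1_seq mu) ?msupp_uniq //= coefZ coefXn eqxx mulr1.
rewrite big_seq_cond big1 ?addr0 // => nu /andP[nu_p nu_mu].
rewrite coefZ coefXn; case: eqP => [e|]; last by rewrite mulr0.
case/eqP: nu_mu; apply/mnmP => i; symmetry.
by apply: (@digits_inj B) e i => i; apply: digit.
Qed.

Section FiniteDifferences.
Variable W : finType.
Implicit Types (F G : (W -> nat) -> rat) (t : W -> nat).

Definition bump_at (i : W) (k : nat) t : W -> nat :=
  fun j => (t j + k * (j == i))%N.

Definition wsize t : nat := (\sum_i t i)%N.

Lemma wsize_bump i k t : wsize (bump_at i k t) = (wsize t + k)%N.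
Proof.
rewrite /wsize big_split /= -big_distrr /=; congr (_ + _)%N.
by rewrite (bigD1 i) //= eqxx big1 ?addn0 ?muln1 // => j /negbTE ->.
Qed.

Lemma bump_atS i k t : bump_at i 1 (bump_at i k t) = bump_at i k.+1 t.
Proof. by apply/funext => j; rewrite /bump_at -addnA -mulnDl addn1. Qed.

Definition fdiff i k F : (W -> nat) -> rat := fun t => F (bump_at i k t) - F t.

(** For polynomial functions this is having total degree less than d; stated by
    differences it can be read off from the growth of the values. *)
Fixpoint deg_lt (d : nat) F : Prop :=
  if d is d'.+1 then forall i, deg_lt d' (fdiff i 1 F) else forall t, F t = 0.

Lemma deg_ltW d F : deg_lt d F -> deg_lt d.+1 F.
Proof.
elim: d F => [|d IHd] F /= F_lt i => [t|]; first by rewrite /fdiff !F_lt subrr.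
exact/IHd/F_lt.
Qed.

Lemma eq_deg_lt d F G : F =1 G -> deg_lt d F -> deg_lt d G.
Proof. by move/funext=> ->. Qed.

Lemma deg_lt0 d F : (forall t, F t = 0) -> deg_lt d F.
Proof. by move=> F0; elim: d => [//|d /deg_ltW]. Qed.

Lemma deg_ltD d F G : deg_lt d F -> deg_lt d G -> deg_lt d (fun t => F t + G t).
Proof.
elim: d F G => [|d IHd] F G /= F_lt G_lt => [t|i].
  by rewrite F_lt G_lt addr0.
apply: eq_deg_lt (IHd _ _ (F_lt i) (G_lt i)) => t.
by rewrite /fdiff; ring.
Qed.

Lemma deg_lt_shift d i k F : deg_lt d F -> deg_lt d (fun t => F (bump_at i k t)).
Proof.
elim: d F => [|d IHd] F /= F_lt => [t //|j].
apply: eq_deg_lt (IHd _ (F_lt j)) => t; rewrite /fdiff; congr (F _ - _).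
by apply/funext => a; rewrite /bump_at; lia.
Qed.

Lemma deg_ltM d e F G :
  deg_lt d F -> deg_lt e G -> deg_lt (d + e) (fun t => F t * G t).
Proof.
move: {2}(d + e)%N (leqnn (d + e)) => s; elim: s d e F G => [|s IHs] d e F G.
  by rewrite leqn0 addn_eq0 => /andP[/eqP-> /eqP->] /= F0 _ t; rewrite F0 mul0r.
case: d => [|d] le_s F_lt G_lt; first by apply: deg_lt0 => t; rewrite F_lt mul0r.
case: e le_s G_lt => [|e] le_s G_lt.
  by apply: deg_lt0 => t; rewrite G_lt mulr0.
move=> i; have -> : fdiff i 1 (fun t => F t * G t) = fun t =>
    fdiff i 1 F t * G (bump_at i 1 t) + F t * fdiff i 1 G t.
  by apply/funext => t; rewrite /fdiff; ring.
apply: deg_ltD; first by apply: IHs (F_lt i) _; [lia | exact: deg_lt_shift].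
by rewrite addnS -addSn; apply: IHs F_lt (G_lt i); lia.
Qed.

Definition polyfun F : Prop := exists d, deg_lt d F.

Lemma polyfun_const c : polyfun (fun=> c).
Proof. by exists 1%N => i t; rewrite /fdiff subrr. Qed.

Lemma polyfun_coord i : polyfun (fun t => (t i)%:R).
Proof.
exists 2%N => j k t /=; rewrite /fdiff /bump_at !natrD.
by ring.
Qed.

Lemma polyfunM F G : polyfun F -> polyfun G -> polyfun (fun t => F t * G t).
Proof. by move=> [d F_lt] [e G_lt]; exists (d + e)%N; apply: deg_ltM. Qed.

Lemma polyfunD F G : polyfun F -> polyfun G -> polyfun (fun t => F t + G t).
Proof.
move=> [d F_lt] [e G_lt]; exists (d + e)%N; apply: deg_ltD.
  by elim: e {G_lt} => [|e IHe]; rewrite ?addn0 // addnS; apply: deg_ltW.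
by elim: d {F_lt} => [|d IHd]; rewrite ?add0n // addSn; apply: deg_ltW.
Qed.

Lemma polyfun_sum (I : Type) (r : seq I) (P : pred I) (F : I -> (W -> nat) -> rat) :
  (forall i, polyfun (F i)) -> polyfun (fun t => \sum_(i <- r | P i) F i t).
Proof.
move=> F_poly; elim: r => [|i r IHr].
  by under [X in polyfun X]funext do rewrite big_nil; apply: polyfun_const.
under [X in polyfun X]funext do rewrite big_cons.
by case: (P i) => //; apply: polyfunD.
Qed.

Lemma polyfun_prod (I : Type) (r : seq I) (P : pred I) (F : I -> (W -> nat) -> rat) :
  (forall i, polyfun (F i)) -> polyfun (fun t => \prod_(i <- r | P i) F i t).
Proof.
move=> F_poly; elim: r => [|i r IHr].
  by under [X in polyfun X]funext do rewrite big_nil; apply: polyfun_const.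
under [X in polyfun X]funext do rewrite big_cons.
by case: (P i) => //; apply: polyfunM.
Qed.

Lemma polyfun_meval m (p : {mpoly rat[m]}) (v : (W -> nat) -> 'I_m -> rat) :
  (forall i, polyfun (fun t => v t i)) -> polyfun (fun t => p.@[v t]).
Proof.
move=> v_poly; under [X in polyfun X]funext do rewrite mevalE.
apply: polyfun_sum => mu; apply: polyfunM; first exact: polyfun_const.
apply: polyfun_prod => i.
elim: (mu i) => [|k IHk]; first exact: polyfun_const.
by under [X in polyfun X]funext do rewrite exprS; apply: polyfunM.
Qed.

Lemma fdiff0_const F : (forall i t, fdiff i 1 F t = 0) -> forall t, F t = F (fun=> 0%N).
Proof.
move=> dF0 t; move: {2}(wsize t) (erefl (wsize t)) => s.
elim: s t => [|s IHs] t e.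
  congr F; apply/funext => i.
  by move/eqP: e; rewrite sum_nat_eq0 => /forallP/(_ i)/eqP.
have [i ti] : exists i, (0 < t i)%N.
  apply/existsP; apply: contraT; rewrite negb_exists => /forallP t0.
  by move: e; rewrite /wsize big1 // => i _; apply/eqP; have := t0 i; rewrite -eqn0Ngt.
pose t' j := (t j - (j == i))%N.
have tE : t = bump_at i 1 t'.
  by apply/funext => j; rewrite /bump_at /t' mul1n subnK //; case: eqP => [->|].
have := dF0 i t'; rewrite /fdiff -tE => /eqP; rewrite subr_eq0 => /eqP ->.
by apply: IHs; move: e; rewrite tE wsize_bump addn1 => -[].
Qed.

(** The first differences have smaller degree and vanish on a smaller simplex, so
    by induction they vanish everywhere. *)
Lemma deg_lt_vanish_simplex d F :
  deg_lt d F -> (forall t, (wsize t < d)%N -> F t = 0) -> forall t, F t = 0.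
Proof.
elim: d F => [//|d IHd] F /= F_lt F0 t.
rewrite fdiff0_const; first by apply: F0; rewrite /wsize big1.
move=> i; apply: IHd (F_lt i) _ => {}t t_lt.
by rewrite /fdiff !F0 ?subrr ?wsize_bump //; lia.
Qed.

(** Polynomial identities extend from large arguments to all of them, in
    particular to families t with zero entries such as t^B. *)
Lemma polyfun_vanish_ge c F :
  polyfun F -> (forall t, (forall i, (c <= t i)%N) -> F t = 0) -> forall t, F t = 0.
Proof.
move=> [d]; elim: d F => [//|d IHd] F F_lt F0 t.
rewrite fdiff0_const => [|i {}t].
  by rewrite -(fdiff0_const _ (fun=> c)) ?F0 // => i {}t;
     apply: IHd (F_lt i) _ _ => u cu; rewrite /fdiff !F0 ?subrr // => j;
     rewrite (leq_trans (cu j)) ?leq_addr.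
apply: IHd (F_lt i) _ _ => u cu; rewrite /fdiff !F0 ?subrr // => j.
by rewrite (leq_trans (cu j)) ?leq_addr.
Qed.

Definition fdiffs (k : nat) (s : seq W) F := foldr (fun i => fdiff i k) F s.

Lemma deg_lt_fdiffs d F :
  deg_lt d F <-> forall s, size s = d -> forall t, fdiffs 1 s F t = 0.
Proof.
elim: d F => [|d IHd] F /=.
  by split=> [F0 s /size0nil -> //|F0 t]; apply: (F0 [::]).
split=> [F_lt s|F0 i].
  case/lastP: s => // s i; rewrite size_rcons => -[/(proj1 (IHd _) (F_lt i)) dF0] t.
  by have := dF0 t; rewrite /fdiffs foldr_rcons.
apply/IHd => s sd t; rewrite -(F0 (rcons s i) _ t) ?size_rcons ?sd //.
by rewrite /fdiffs foldr_rcons.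
Qed.

Lemma fdiff_sum i k F t :
  fdiff i k F t = \sum_(j < k) fdiff i 1 F (bump_at i j t).
Proof.
elim: k => [|k IHk].
  rewrite big_ord0 /fdiff; apply/eqP; rewrite subr_eq0; apply/eqP; congr F.
  by apply/funext => j; rewrite /bump_at mul0n addn0.
rewrite big_ord_recr /= -IHk /fdiff bump_atS; ring.
Qed.

Lemma fdiffC i j k l F : fdiff i k (fdiff j l F) = fdiff j l (fdiff i k F).
Proof.
apply/funext => t; rewrite /fdiff.
have -> : bump_at j l (bump_at i k t) = bump_at i k (bump_at j l t).
  by apply/funext => a; rewrite /bump_at; lia.
ring.
Qed.

Lemma fdiffsC i k s l F : fdiffs k s (fdiff i l F) = fdiff i l (fdiffs k s F).
Proof. by elim: s => //= j s ->; rewrite fdiffC. Qed.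

Lemma fdiffs_const k s F c :
  (forall t, fdiffs 1 s F t = c) -> forall t, fdiffs k s F t = k%:R ^+ size s * c.
Proof.
elim: s F c => [|i s IHs] F c /= dF t; first by rewrite mul1r dF.
rewrite fdiff_sum -fdiffsC (eq_bigr (fun=> k%:R ^+ size s * c)) => [|j _].
  by rewrite sumr_const card_ord exprS -mulrA mulr_natl.
by apply: IHs => {}t; rewrite fdiffsC.
Qed.

Lemma fdiffs_bound k s F (b : nat -> rat) :
  {homo b : x y / (x <= y)%N >-> x <= y} -> (forall t, `|F t| <= b (wsize t)) ->
  forall t, `|fdiffs k s F t| <= 2 ^+ size s * b (wsize t + size s * k)%N.
Proof.
move=> b_mono Fb; elim: s => [|i s IHs] t /=; first by rewrite mul1r addn0.
rewrite {1}/fdiff (le_trans (ler_normB _ _)) // exprS -mulrA mulr_natl mulr2n lerD //.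
  by rewrite (le_trans (IHs _)) // wsize_bump mulSn addnA.
rewrite (le_trans (IHs _)) // ler_wpM2l ?exprn_ge0 // b_mono //.
by rewrite leq_add2l mulSn leq_addl.
Qed.

(** When the d-fold unit differences are constant, those with steps of length k
    are k ^ d times larger; a growth of order m < d bounds them by a multiple of
    k ^ m, so they vanish. *)
Lemma deg_lt_growth1 d m (C : rat) F : (m < d)%N -> deg_lt d.+1 F ->
  (forall t, `|F t| <= C * (wsize t + 2)%:R ^+ m) -> deg_lt d F.
Proof.
move=> md F_lt F_growth.
have C_ge0 : 0 <= C.
  have := le_trans (normr_ge0 _) (F_growth (fun=> 0%N)).
  by rewrite pmulr_lge0 // exprn_gt0 // ltr0n addn2.
apply/deg_lt_fdiffs => s sd t; pose c := fdiffs 1 s F (fun=> 0%N).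
have dFc u : fdiffs 1 s F u = c.
  apply: fdiff0_const => i {}u.
  exact: (proj1 (deg_lt_fdiffs d.+1 F) F_lt (i :: s) (congr1 S sd) u).
rewrite dFc; apply/eqP; rewrite -normr_eq0; apply: contraT => c_neq0.
have c_gt0 : 0 < `|c| by rewrite lt_neqAle eq_sym c_neq0 normr_ge0.
(* As d * k + 2 <= (d + 2) * k, the growth bound on k ^ d |c| is at most M k ^ m. *)
pose M : rat := 2 ^+ d * (C * (d + 2)%:R ^+ m).
pose k := (Num.truncn (M / `|c|)).+1.
have Mk : M < k%:R * `|c| by rewrite -ltr_pdivrMr // truncnS_gt.
have k_gt0 : (0 : rat) < k%:R by rewrite ltr0n.
have := @fdiffs_bound k s F (fun x => C * (x + 2)%:R ^+ m) _ F_growth (fun=> 0%N).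
rewrite (fdiffs_const _ dFc) sd => bound.
have {bound} : `|k%:R ^+ d * c| <= 2 ^+ d * (C * ((wsize (fun=> 0%N)) + d * k + 2)%:R ^+ m).
  apply: bound => x y xy; rewrite ler_wpM2l // lerXn2r ?nnegrE ?ler0n //.
  by rewrite ler_nat leq_add2r.
rewrite normrM ger0_norm ?exprn_ge0 ?ler0n //.
have -> : wsize (fun=> 0%N) = 0%N by rewrite /wsize big1.
rewrite add0n => bound.
have step : 2 ^+ d * (C * (d * k + 2)%:R ^+ m) <= M * k%:R ^+ m.
  rewrite /M -!mulrA ler_wpM2l ?exprn_ge0 // ler_wpM2l // -exprMn.
  rewrite lerXn2r ?nnegrE ?ler0n ?mulr_ge0 // -natrM ler_nat mulnDl leq_add2l.
  by rewrite leq_pmulr.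
have := le_trans bound step.
have -> : k%:R ^+ d = k%:R ^+ (d - m.+1) * k%:R * k%:R ^+ m :> rat.
  by rewrite -exprSr -exprD subnSK // subnK // ltnW.
rewrite mulrAC ler_pM2r ?exprn_gt0 // => le_M.
suff : k%:R * `|c| <= M by rewrite leNgt Mk.
apply: le_trans le_M; rewrite ler_pM2r // ler_peMl ?ler0n //.
by rewrite exprn_ege1 // ler1n.
Qed.

Lemma polyfun_growth m (C : rat) F : polyfun F ->
  (forall t, `|F t| <= C * (wsize t + 2)%:R ^+ m) -> deg_lt m.+1 F.
Proof.
move=> [d F_lt] F_growth; case: (leqP d m.+1) => [dm|].
  by rewrite -(subnK dm); elim: (m.+1 - d)%N => [//|e IHe]; apply: deg_ltW.
elim: d F_lt => [//|d IHd] F_lt; rewrite ltnS leq_eqVlt => /predU1P[|md].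
  by move=> e; move: F_lt; rewrite -e => F_lt; apply: deg_lt_growth1 F_lt F_growth.
by apply: IHd => //; apply: deg_lt_growth1 F_lt F_growth; apply: ltnW.
Qed.

End FiniteDifferences.

(** * Tight sets and exchange relations *)

Section Cells.
Variable n : nat.
Implicit Types (f : {set 'I_n} -> int) (a : 'rV[int]_n) (A : {set 'I_n}).
Implicit Types (r : rel 'I_n) (i j : 'I_n).

Definition coord_sum a A : int := \sum_(i in A) a 0 i.

Definition tight f a A : bool := coord_sum a A == f A.

Definition rclosed r A : bool := [forall i in A, forall j, r i j ==> (j \in A)].

(** For a preorder r, membership in the cell means that a unit can be moved from i
    to j inside P_f exactly when r j i holds: see exchange_cell. *)
Definition cell f r a : bool :=
  base_points f a && [forall A, tight f a A == rclosed r A].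

Lemma rclosedP r A :
  reflect (forall i j, i \in A -> r i j -> j \in A) (rclosed r A).
Proof.
apply: (iffP forall_inP) => [H i j iA rij|H i iA].
  by have /forallP/(_ j)/implyP := H i iA; apply.
by apply/forallP => j; apply/implyP; apply: H iA.
Qed.

Lemma base_pointsP f a :
  reflect ((forall A, coord_sum a A <= f A) /\ coord_sum a setT = f setT)
          (base_points f a).
Proof.
have sumT : coord_sum a setT = \sum_i a 0 i.
  by apply: eq_bigl => i; rewrite inE.
rewrite /base_points -sumT.
apply: (iffP andP) => [[/forallP H /eqP //]|[H1 H2]].
by split; [apply/forallP | apply/eqP].
Qed.

Lemma coord_sum_exchange a i j A :
  coord_sum (a - basis_vec i + basis_vec j) A =
  coord_sum a A - (i \in A)%:R + (j \in A)%:R.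
Proof.
rewrite /coord_sum; have sum_basis k : \sum_(l in A) basis_vec k 0 l = (k \in A)%:R.
  case: (boolP (k \in A)) => kA.
    rewrite (bigD1 k) //= big1 ?addr0 ?mxE ?eqxx // => l /andP[_ /negbTE lk].
    by rewrite mxE lk andbF.
  by rewrite big1 // => l lA; rewrite mxE eqxx; case: (l =P k) lA kA => [-> ->|].
rewrite -!sum_basis -sumrN -!big_split /=; apply: eq_bigr => k _.
by rewrite !mxE.
Qed.

(** Only a tight set containing j but not i obstructs the exchange, as all the
    quantities are integers; if r j i fails, the set of indices above j is one. *)
Lemma exchange_cell f r a i j : reflexive r -> transitive r -> cell f r a ->
  base_points f (a - basis_vec i + basis_vec j) = r j i.
Proof.
move=> r_refl r_trans /andP[/base_pointsP[af aT] /forallP tightE].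
apply/base_pointsP/idP => [[bf _]|rji].
  apply: contraT => nrji; pose A := [set k | r j k].
  have /eqP A_tight : tight f a A.
    rewrite (eqP (tightE A)); apply/rclosedP => k l; rewrite !inE.
    exact: r_trans.
  have := bf A; rewrite coord_sum_exchange A_tight !inE r_refl (negbTE nrji).
  by lia.
split=> [A|]; last by rewrite coord_sum_exchange !inE aT; lia.
rewrite coord_sum_exchange; have := af A.
case jA: (j \in A); last by case: (i \in A); lia.
case iA: (i \in A); first by lia.
have : ~~ tight f a A.
  rewrite (eqP (tightE A)); apply/negP => /rclosedP/(_ j i jA rji).
  by rewrite iA.
by rewrite /tight; lia.
Qed.

(** These are the internally active indices of the points in the cell of r, and
    the externally active ones when r is reversed. *)
Definition label_min r : {set 'I_n} :=
  [set i : 'I_n | [forall j : 'I_n, (j < i)%N ==> ~~ r j i]].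

Lemma label_minP r i :
  reflect (forall j, (j < i)%N -> ~~ r j i) (i \in label_min r).
Proof.
rewrite inE; apply: (iffP forallP) => H j; first exact/implyP.
by apply/implyP; apply: H.
Qed.

Lemma int_active_cell f r a : reflexive r -> transitive r -> cell f r a ->
  int_active (base_points f) a = label_min r.
Proof.
move=> r_refl r_trans a_cell; apply/setP => i; rewrite !inE negb_exists.
by apply: eq_forallb => j; rewrite (exchange_cell _ _ r_refl r_trans a_cell) negb_and implybE.
Qed.

Lemma ext_active_cell f r a : reflexive r -> transitive r -> cell f r a ->
  ext_active (base_points f) a = label_min (fun i j : 'I_n => r j i).
Proof.
move=> r_refl r_trans a_cell; apply/setP => i; rewrite !inE negb_exists.
apply: eq_forallb => j; rewrite addrAC.
by rewrite (exchange_cell _ _ r_refl r_trans a_cell) negb_and implybE.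
Qed.

(** Every index lies above a label minimum, and below a label minimum of the
    reversed relation.  When the two sets of minima agree these two elements are
    comparable members of both, hence equal, and the index is equivalent to this
    element.  So comparable indices are equivalent to comparable, thus equal,
    minima. *)
Lemma label_min_sym r : reflexive r -> transitive r ->
  label_min r = label_min (fun i j : 'I_n => r j i) -> ssrbool.symmetric r.
Proof.
move=> r_refl r_trans minE.
have below r' : reflexive r' -> transitive r' ->
    forall i, exists2 m, m \in label_min r' & r' m i.
  move=> r'_refl r'_trans i.
  case: (@arg_minnP _ i (r'^~ i) (fun j => j : nat) (r'_refl i)) => m r'mi m_min.
  exists m => //; apply/label_minP => j; apply: contraTN => r'jm.
  by rewrite -leqNgt m_min // (r'_trans m).
have repr i : exists m, [/\ m \in label_min r, r m i & r i m].
  have [m m_min rmi] := below r r_refl r_trans i.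
  have r_trans' : transitive (fun i j : 'I_n => r j i).
    by move=> j k l rkj rlk; apply: r_trans rkj.
  have [m' m'_min rim'] := below (fun i j : 'I_n => r j i) r_refl r_trans' i.
  have rmm' : r m m' by apply: r_trans rmi rim'.
  suff e : m = m' by exists m; split; rewrite // e.
  apply/val_inj; case: (ltngtP m m') => // [lt_m|lt_m'].
    by move: m'_min; rewrite -minE => /label_minP/(_ m lt_m); rewrite rmm'.
  by move: m_min; rewrite minE => /label_minP/(_ m' lt_m'); rewrite rmm'.
suff impl i j : r i j -> r j i by move=> i j; apply/idP/idP; apply: impl.
move=> rij; have [mi [mi_min rmi rim]] := repr i; have [mj [mj_min rmj rjm]] := repr j.
have rmm : r mi mj by apply: (r_trans i) => //; apply: (r_trans j).
suff e : mi = mj by apply: (r_trans mj); rewrite // -e.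
apply/val_inj; case: (ltngtP mi mj) => // [lt_m|lt_m].
  by move: mj_min => /label_minP/(_ mi lt_m); rewrite rmm.
by move: mi_min; rewrite minE => /label_minP/(_ mj lt_m); rewrite rmm.
Qed.

Definition exchange_rel f a : rel 'I_n :=
  fun i j => [forall A, tight f a A && (i \in A) ==> (j \in A)].

Lemma exchange_relP f a i j :
  reflect (forall A, tight f a A -> i \in A -> j \in A) (exchange_rel f a i j).
Proof.
apply: (iffP forallP) => H A; first by move=> At iA; have /implyP := H A; apply; apply/andP.
by apply/implyP => /andP[]; apply: H.
Qed.

Lemma exchange_rel_refl f a : reflexive (exchange_rel f a).
Proof. by move=> i; apply/exchange_relP. Qed.

Lemma exchange_rel_trans f a : transitive (exchange_rel f a).
Proof.
move=> j i k /exchange_relP rij /exchange_relP rjk; apply/exchange_relP => A At iA.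
exact: (rjk A At (rij A At iA)).
Qed.

Lemma cell_rel f r a : reflexive r -> transitive r -> cell f r a ->
  forall i j, r i j = exchange_rel f a i j.
Proof.
move=> r_refl r_trans /andP[_ /forallP tightE] i j.
apply/idP/exchange_relP => [rij A|]; first by rewrite (eqP (tightE A)) => /rclosedP H iA; apply: H iA rij.
move/(_ [set k | r i k]); rewrite !inE; apply => //.
by rewrite (eqP (tightE _)); apply/rclosedP => k l; rewrite !inE; apply: r_trans.
Qed.

Lemma coord_sumUI a A A' :
  coord_sum a (A :|: A') + coord_sum a (A :&: A') = coord_sum a A + coord_sum a A'.
Proof.
have mk B : coord_sum a B = \sum_i (if i \in B then a 0 i else 0).
  by rewrite /coord_sum big_mkcond.
rewrite !mk -!big_split /=; apply: eq_bigr => i _.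
by rewrite !inE; case: (i \in A); case: (i \in A'); rewrite ?addr0 ?add0r.
Qed.

Lemma tightUI f a A A' : submodular f -> base_points f a ->
  tight f a A -> tight f a A' -> tight f a (A :|: A') && tight f a (A :&: A').
Proof.
move=> [_ /(_ A A') f_sub] /base_pointsP[af _] /eqP At /eqP A't.
have := af (A :|: A'); have := af (A :&: A'); have := coord_sumUI a A A'.
by rewrite /tight At A't; lia.
Qed.

(** The smallest tight set containing i is the set of indices above i, and a
    closed set is a union of such sets. *)
Lemma cell_exchange_rel f a : submodular f -> base_points f a ->
  cell f (exchange_rel f a) a.
Proof.
move=> f_sub aP; rewrite /cell aP; apply/forallP => A; apply/eqP; apply/idP/rclosedP.
  by move=> At i j iA /exchange_relP/(_ A At iA).
move=> A_closed; have /base_pointsP[_ aT] := aP.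
pose hull i := \bigcap_(A' | tight f a A' && (i \in A')) A'.
have -> : A = \bigcup_(i in A) hull i.
  apply/setP => j; apply/idP/bigcupP => [jA|[i iA /bigcapP ij]].
    by exists j => //; apply/bigcapP => A' /andP[].
  apply: A_closed iA _; apply/exchange_relP => A' A't iA'.
  by apply: ij; rewrite A't.
apply: (big_ind (fun A => tight f a A)).
- by rewrite /tight /coord_sum big_set0 (proj1 f_sub).
- by move=> A1 A2 A1t A2t; case/andP: (tightUI f_sub aP A1t A2t).
move=> i _; apply: (big_ind (fun A => tight f a A)); first exact/eqP.
  by move=> A1 A2 A1t A2t; case/andP: (tightUI f_sub aP A1t A2t).
by move=> A' /andP[].
Qed.

(** Sums over P_f become big operators over a sequence, and counting its elements
    becomes count. *)
Definition points f : seq 'rV[int]_n :=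
  xget [::] [set s : seq 'rV[int]_n | uniq s /\ s =i base_points f]%classic.

Lemma pointsP f : uniq (points f) /\ points f =i base_points f.
Proof.
have /finite_seqP[s sE] := finite_base_points f.
apply: (@xgetPex _ [::] [set s : seq _ | uniq s /\ s =i base_points f]%classic).
exists (undup s); split=> [|a]; first exact: undup_uniq.
rewrite mem_undup; apply/idP/idP.
  by move=> sa; have : [set` s]%classic a by []; rewrite -sE.
by move=> aP; have : [set a | base_points f a]%classic a by []; rewrite sE.
Qed.

Lemma tutteE f (R : comNzRingType) (x y : R) : tutte (base_points f) x y =
  \sum_(a <- points f)
     x ^+ #|int_active (base_points f) a :\: ext_active (base_points f) a| *
     y ^+ #|ext_active (base_points f) a :\: int_active (base_points f) a| *
     (x + y - 1) ^+ #|int_active (base_points f) a :&: ext_active (base_points f) a|.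
Proof.
have [s_uniq sE] := pointsP f; rewrite /tutte [RHS]fsbig_seq //.
by apply: eq_fsbigl; apply/seteqP; split=> a /=; have := sE a; rewrite [a \in base_points f]/in_mem /= => ->.
Qed.

End Cells.

(** * Minkowski sums of simplices *)

Section Hypergraphic.
Variable n : nat.
Implicit Types (t u : neset n -> nat) (A : {set 'I_n}) (J : neset n).

Definition hyper_rank t A : nat :=
  (\sum_(J : neset n | val J :&: A != set0) t J)%N.

Definition hyper_fun t A : int := (hyper_rank t A)%:Z.

Lemma set_meetsP (I A : {set 'I_n}) :
  reflect (exists i, i \in I /\ i \in A) (I :&: A != set0).
Proof.
apply: (iffP (set0Pn _)) => -[i]; first by rewrite inE => /andP[]; exists i.
by case=> iI iA; exists i; rewrite inE iI.
Qed.

Lemma set_meetsU (I A A' : {set 'I_n}) :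
  (I :&: (A :|: A') != set0) = (I :&: A != set0) || (I :&: A' != set0).
Proof. by rewrite setIUr setU_eq0 negb_and. Qed.

Lemma hyper_rankE t A :
  hyper_rank t A = (\sum_J (val J :&: A != set0) * t J)%N.
Proof.
by rewrite /hyper_rank big_mkcond; apply: eq_bigr => J _; case: ifP; rewrite ?mul1n.
Qed.

Lemma hyper_rankU t A A' :
  (hyper_rank t A + hyper_rank t A' = hyper_rank t (A :|: A') +
   \sum_(J | (val J :&: A != set0) && (val J :&: A' != set0)) t J)%N.
Proof.
rewrite !hyper_rankE [in X in (_ = _ + X)%N]big_mkcond /= -!big_split /=.
apply: eq_bigr => J _; rewrite set_meetsU.
by case: (val J :&: A != set0); case: (val J :&: A' != set0); rewrite /=; lia.
Qed.

Lemma hyper_fun_submodular t : submodular (hyper_fun t).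
Proof.
split=> [|A A']; first by rewrite /hyper_fun /hyper_rank big_pred0 // => J; rewrite setI0 eqxx.
rewrite /hyper_fun -!PoszD lez_nat [X in (_ <= X)%N]hyper_rankU leq_add2l hyper_rankE [X in (_ <= X)%N]big_mkcond.
apply: leq_sum => J _; case: ifP => meets_both; first by case: (_ != _); rewrite ?mul1n.
case: set_meetsP => [[i []]|//]; rewrite inE => iJ /andP[iA iA'].
by case/andP: meets_both; split; apply/set_meetsP; exists i.
Qed.

Lemma hyper_rankT t : hyper_rank t setT = wsize t.
Proof.
rewrite /hyper_rank /wsize; apply: eq_bigl => J.
by rewrite setIT (valP J).
Qed.

Section Blocks.
Variables (l : nat) (b : 'I_n -> nat).
Hypothesis b_lt : forall i, (b i < l)%N.
Hypothesis b_surj : forall k, (k < l)%N -> exists i, b i = k.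

Definition same_block : rel 'I_n := fun i j => b i == b j.

Lemma same_block_refl : reflexive same_block.
Proof. by move=> i; apply: eqxx. Qed.

Lemma same_block_trans : transitive same_block.
Proof. by move=> j i k /eqP bij /eqP bjk; apply/eqP; rewrite bij. Qed.

Lemma card_label_min_block : #|label_min same_block| = l.
Proof.
pose b' i := Ordinal (b_lt i).
rewrite -[RHS](card_ord l) -cardsT.
have /card_in_imset <- : {in label_min same_block &, injective b'}.
  move=> i j /label_minP i_min /label_minP j_min [e]; apply/val_inj.
  case: (ltngtP i j) => // [/j_min|/i_min]; first by rewrite /same_block e eqxx.
  by rewrite /same_block e eqxx.
apply: eq_card => k; rewrite [RHS]inE; apply/imsetP.
have [i0 bi0] := b_surj (ltn_ord k).
have bi0k : b i0 == k by apply/eqP.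
case: (@arg_minnP _ i0 (fun i => b i == k) (fun j => j : nat) bi0k) => m /eqP bm m_min.
exists m; last exact/val_inj.
apply/label_minP => j; rewrite ltnNge; apply: contra => /eqP bj.
by apply: m_min; rewrite bj bm.
Qed.

Variable u : neset n -> nat.
Hypothesis u_supp : forall J, (0 < u J)%N ->
  {in val J &, forall i j, b i = b j}.
Hypothesis u_full : forall i, exists2 J, (0 < u J)%N & forall j, b j = b i -> j \in val J.

(** The ranks of A and of its complement add up to the total rank plus the number
    of simplices meeting both, whereas coordinate sums add up exactly; and the
    simplices of the sum meet both unless A is a union of blocks. *)
Lemma tight_compl_saturated a A : base_points (hyper_fun u) a ->
  tight (hyper_fun u) a A && tight (hyper_fun u) a (~: A) = rclosed same_block A.
Proof.
move=> /base_pointsP[af aT].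
have sumC : coord_sum a A + coord_sum a (~: A) = hyper_fun u setT.
  by rewrite -coord_sumUI setUCr setICr aT /coord_sum big_set0 addr0.
have := hyper_rankU u A (~: A); rewrite setUCr.
set cross := (X in _ = (_ + X)%N) => rankC.
have -> : tight (hyper_fun u) a A && tight (hyper_fun u) a (~: A) = (cross == 0%N).
  have := af A; have := af (~: A); move: rankC sumC.
  rewrite /tight /hyper_fun => rankC sumC afC afA.
  by apply/andP/eqP => [[/eqP ? /eqP ?]|?]; [lia | split; apply/eqP; lia].
rewrite sum_nat_eq0; apply/forall_inP/rclosedP => [cross0 i j iA /eqP bij|A_sat J].
  apply: contraT => jA; have [J uJ J_full] := u_full i.
  have /cross0/eqP : (val J :&: A != set0) && (val J :&: ~: A != set0).
    apply/andP; split; apply/set_meetsP; first by exists i; rewrite J_full.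
    by exists j; rewrite inE jA J_full.
  by move=> uJ0; rewrite uJ0 in uJ.
case/andP => /set_meetsP[i [iJ iA]] /set_meetsP[j [jJ]]; rewrite inE => /negP jA.
rewrite -leqn0 leqNgt; apply/negP => uJ; apply: jA.
by apply: A_sat iA _; apply/eqP/(u_supp uJ).
Qed.

Lemma symmetric_exchange_cell a : base_points (hyper_fun u) a ->
  ssrbool.symmetric (exchange_rel (hyper_fun u) a) -> cell (hyper_fun u) same_block a.
Proof.
move=> aP r_sym; rewrite /cell aP; apply/forallP => A; apply/eqP.
rewrite -(tight_compl_saturated A aP); case At: (tight _ a A) => //=; symmetry.
have /andP[_ /forallP tightE] := cell_exchange_rel (hyper_fun_submodular u) aP.
rewrite (eqP (tightE _)); apply/rclosedP => i j; rewrite !inE => iA.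
rewrite r_sym => /exchange_relP rji; apply: contra iA => jA.
exact: rji At jA.
Qed.

(** A power of 0 kills the points whose internal and external activities differ.
    The others have a symmetric exchange relation, which makes their tight sets
    the unions of blocks; the number of label minima is then the number l of
    blocks, and the remaining factor is (0 + 0 - 1) ^ l. *)
Lemma tutte00 :
  tutte (base_points (hyper_fun u)) 0 0 =
  (-1) ^+ l *+ count (cell (hyper_fun u) same_block) (points (hyper_fun u)) :> rat.
Proof.
have [_ ptsE] := pointsP (hyper_fun u).
rewrite tutteE -iter_addr_0 -big_const_seq [RHS]big_mkcond /= big_seq [RHS]big_seq; apply: eq_bigr => a.
rewrite ptsE => aP; set I := int_active _ _; set E := ext_active _ _.
case: ifP => [a_cell|a_ncell].
  rewrite {}/E {}/I (int_active_cell same_block_refl same_block_trans a_cell).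
  rewrite (ext_active_cell same_block_refl same_block_trans a_cell).
  have -> : label_min (fun i j : 'I_n => same_block j i) = label_min same_block.
    by congr label_min; apply/funext => i; apply/funext => j; apply: eq_sym.
  by rewrite setDv cards0 setIid card_label_min_block !mul1r addr0 sub0r.
rewrite !expr0n !cards_eq0 !setD_eq0.
case: (boolP (I \subset E)) => IE; last by rewrite !mul0r.
case: (boolP (E \subset I)) => EI; last by rewrite mulr0 mul0r.
have eIE : I = E by apply/eqP; rewrite eqEsubset IE EI.
have a_cell := cell_exchange_rel (hyper_fun_submodular u) aP.
move/negP: a_ncell; case; apply: symmetric_exchange_cell => //.
apply: label_min_sym; [exact: exchange_rel_refl | exact: exchange_rel_trans |].
rewrite -(int_active_cell _ _ a_cell) -?(ext_active_cell _ _ a_cell) //;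
  solve [exact: exchange_rel_refl | exact: exchange_rel_trans].
Qed.

End Blocks.

End Hypergraphic.

(** * Evaluation of the polynomials *)

Section Evaluation.
Variable n : nat.

Definition eval_at (x y : rat) (t : neset n -> rat) (i : 'I_#|{: tutte_var n}|) : rat :=
  match enum_val i with
  | inl k => if k == 0 then x else y
  | inr A => t A
  end.

Lemma meval_psubst (V : finType) k (s : V -> {mpoly rat[k]}) (p : {mpoly rat[#|V|]}) w :
  (psubst s p).@[w] = p.@[fun i => (s (enum_val i)).@[w]].
Proof.
by rewrite /psubst comp_mpoly_meval; apply: meval_eq => i; rewrite tnth_mktuple.
Qed.

Lemma meval_set_subst (s : neset n -> tutte_ring n) p x y t :
  (set_subst s p).@[eval_at x y t] =
  p.@[eval_at x y (fun I => (s I).@[eval_at x y t])].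
Proof.
rewrite meval_psubst; apply: meval_eq => i; rewrite [RHS]/eval_at.
by case: (enum_val i) => // k; rewrite mevalXU /eval_at enum_rankK.
Qed.

Lemma meval_svar x y t (I : neset n) : (svar I).@[eval_at x y t] = t I.
Proof. by rewrite mevalXU /eval_at enum_rankK. Qed.

Lemma meval_xvar x y t : (xvar n).@[eval_at x y t] = x.
Proof. by rewrite mevalXU /eval_at enum_rankK. Qed.

Lemma meval_yvar x y t : (yvar n).@[eval_at x y t] = y.
Proof. by rewrite mevalXU /eval_at enum_rankK. Qed.

Lemma meval_specialize (f : {set 'I_n} -> int) p w :
  (specialize f p).@[w] = p.@[eval_at (w 0) (w 1) (fun I => (f (val I))%:~R)].
Proof.
rewrite meval_psubst; apply: meval_eq => i; rewrite /eval_at.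
case: (enum_val i) => [k|I]; last by rewrite rmorph_int.
rewrite mevalXU; case: eqP => [-> //|k0]; congr w; apply/val_inj.
by case: k k0 => -[|[]] // k_lt []; apply/val_inj.
Qed.

Lemma meval_tutte (f : {set 'I_n} -> int) (w : 'I_2 -> rat) :
  (tutte (base_points f) 'X_0 'X_1).@[w] = tutte (base_points f) (w 0) (w 1).
Proof.
rewrite !tutteE rmorph_sum; apply: eq_bigr => a _.
by rewrite !rmorphM !rmorphXn rmorphB rmorphD rmorph1 /= !mevalXU.
Qed.

Lemma meval_universal (T : tutte_ring n) x y (t : neset n -> nat) : universal_tutte T ->
  (set_subst (@z_of_t n) T).@[eval_at x y (fun I => (t I)%:R)] =
  tutte (base_points (hyper_fun t)) x y.
Proof.
move=> T_univ; pose w (k : 'I_2) := if k == 0 then x else y.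
rewrite (_ : tutte _ x y = (tutte (base_points (hyper_fun t)) 'X_0 'X_1).@[w]); last first.
  by rewrite meval_tutte.
rewrite -(T_univ _ (hyper_fun_submodular t)) meval_specialize meval_set_subst.
apply: meval_eq => i; rewrite /eval_at; case: (enum_val i) => // I.
rewrite /z_of_t rmorph_sum /= /hyper_fun /hyper_rank -pmulrn natr_sum.
by apply: eq_bigr => J _; rewrite meval_svar.
Qed.

Lemma meval_dragon (s : neset n -> tutte_ring n) w :
  (dragon s).@[w] = dragon (fun I => (s I).@[w] : rat^o).
Proof.
have meval_gbinom (p : tutte_ring n) k : (gbinom p k).@[w] = gbinom (p.@[w] : rat^o) k.
  rewrite /gbinom mevalZ rmorph_prod /=; congr (_ * _); apply: eq_bigr => i _.
  by rewrite rmorphB rmorph_nat.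
rewrite /dragon rmorph_sum; apply: eq_bigr => g _; rewrite rmorphM !rmorph_prod /=.
congr (_ * _); apply: eq_bigr => I _; rewrite meval_gbinom //.
by rewrite rmorphB rmorph1.
Qed.

Lemma gbinom_nat (m k : nat) : gbinom (m%:R : rat^o) k = 'C(m, k)%:R.
Proof.
have k_neq0 : k`!%:R != 0 :> rat by rewrite pnatr_eq0 -lt0n fact_gt0.
apply: (mulfI k_neq0); rewrite /gbinom -[_ *: _]/(_ * _) mulrA mulfV // mul1r.
rewrite -natrM mulnC bin_ffact; elim: k {k_neq0} => [|k IHk].
  by rewrite big_ord0 ffactn0.
rewrite big_ord_recr /= IHk ffactnSr natrM; case: (leqP k m) => km.
  by rewrite natrB.
by rewrite ffact_small // !mul0r.
Qed.

End Evaluation.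

(** * Interior lattice points and the dragon polynomial *)

Section Interior.
Variables (n : nat) (n_gt0 : (0 < n)%N).
Implicit Types (h : neset n -> nat) (g : {ffun neset n -> 'I_n}).

Let zero : 'I_n := Ordinal n_gt0.

Lemma setT_neq0 : [set: 'I_n] != set0.
Proof. by apply/set0Pn; exists zero; rewrite inE. Qed.

Definition full_set : neset n := Sub [set: 'I_n] setT_neq0.

(** One copy of the full simplex is set apart, as D_n depends on t_[n] through
    t_[n] - 1: the multiplicities h of the others are its natural arguments. *)
Definition add_full h : neset n -> nat := bump_at full_set 1 h.

Definition interior h : pred 'rV[int]_n :=
  cell (hyper_fun (add_full h)) (same_block (fun=> 0%N)).

Definition interior_count h : nat :=
  count (interior h) (points (hyper_fun (add_full h))).

Lemma full_setE (J : neset n) : (val J == setT) = (J == full_set).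
Proof. by rewrite -(inj_eq val_inj). Qed.

Lemma tutte00_add_full h :
  tutte (base_points (hyper_fun (add_full h))) 0 0 = - (interior_count h)%:R :> rat.
Proof.
rewrite (@tutte00 n 1 (fun=> 0%N)) ?expr1 ?mulNrn //.
- by case=> // _; exists zero.
move=> i; exists full_set => [|j _]; last by rewrite inE.
by rewrite /add_full /bump_at eqxx addn1.
Qed.

Lemma hyper_rank_add_full h (A : {set 'I_n}) : A != set0 ->
  hyper_rank (add_full h) A = (hyper_rank h A).+1.
Proof.
move=> A0; rewrite /hyper_rank /add_full /bump_at big_split /= -[in RHS]addn1.
by congr (_ + _)%N; rewrite (bigD1 full_set) /= ?setTI // eqxx big1 // => J /andP[_ /negbTE->].
Qed.

Lemma hyper_rank_compl h (A : {set 'I_n}) :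
  (hyper_rank h (~: A) + \sum_(J : neset n | val J \subset A) h J = wsize h)%N.
Proof.
rewrite /wsize [RHS](bigID (fun J : neset n => val J :&: ~: A != set0)) /=; congr (_ + _)%N.
by apply: eq_bigl => J; rewrite negbK setI_eq0 disjoints_subset setCK.
Qed.

(** Complementing A turns the strict upper bound on its coordinate sum into a
    lower bound from which the full simplex set apart has disappeared. *)
Lemma interiorP h a :
  reflect (coord_sum a setT = (wsize h).+1%:Z /\
    forall A : {set 'I_n}, A != set0 ->
      (\sum_(J : neset n | val J \subset A) h J)%N.+1%:Z <= coord_sum a A)
    (interior h a).
Proof.
have rankT : hyper_fun (add_full h) setT = (wsize h).+1.
  by rewrite /hyper_fun hyper_rank_add_full ?setT_neq0 // hyper_rankT.
have sumC A : coord_sum a A + coord_sum a (~: A) = coord_sum a setT.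
  by rewrite -coord_sumUI setUCr setICr /coord_sum big_set0 addr0.
have closedE A : rclosed (same_block (fun=> 0%N)) A = (A == set0) || (A == setT).
  apply/rclosedP/orP => [A_cl|[] /eqP-> i j]; rewrite ?inE //.
  case: (set_0Vmem A) => [->|[i iA]]; first by left.
  by right; apply/eqP/setP => j; rewrite inE (A_cl i).
apply: (iffP andP) => [[/base_pointsP[af aT] /forallP tightE]|[aT lower]].
  split=> [|A A0]; first by rewrite aT.
  case: (eqVneq A setT) => [->|AT].
    rewrite aT rankT lez_nat ltnS /wsize [leqRHS](bigID (fun J : neset n => val J \subset setT)) /=.
    exact: leq_addr.
  have CA0 : ~: A != set0 by rewrite -setCT (inj_eq (can_inj (@setCK _))).
  have := tightE (~: A); rewrite closedE (negbTE CA0) orFb -setC0 (inj_eq (can_inj (@setCK _))).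
  rewrite (negbTE A0) eqbF_neg /tight.
  have := af (~: A); have := sumC A; rewrite aT rankT /hyper_fun hyper_rank_add_full //.
  by have := hyper_rank_compl h A; lia.
have strict A : A != set0 -> A != setT -> coord_sum a A < hyper_fun (add_full h) A.
  move=> A0 AT; have CA0 : ~: A != set0 by rewrite -setCT (inj_eq (can_inj (@setCK _))).
  rewrite /hyper_fun hyper_rank_add_full //.
  have := lower _ CA0; have := sumC A; have := hyper_rank_compl h (~: A).
  by rewrite setCK aT; lia.
have aT' : coord_sum a setT = hyper_fun (add_full h) setT by rewrite aT rankT.
have a0 : coord_sum a set0 = hyper_fun (add_full h) set0.
  by rewrite (proj1 (hyper_fun_submodular _)) /coord_sum big_set0.
split.
  apply/base_pointsP; split=> // A.
  case: (eqVneq A set0) => [->|A0]; first by rewrite a0.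
  case: (eqVneq A setT) => [->|AT]; first by rewrite aT'.
  exact/ltW/strict.
apply/forallP => A; rewrite closedE /tight.
case: (eqVneq A set0) => [->|A0]; first by rewrite a0 eqxx.
case: (eqVneq A setT) => [->|AT]; first by rewrite aT' eqxx.
by rewrite orbF eqbF_neg lt_eqF ?strict.
Qed.

Lemma draconianP h :
  reflect (wsize h = n.-1 /\ forall A : {set 'I_n}, A != set0 ->
            (\sum_(J : neset n | val J \subset A) h J < #|A|)%N)
    (draconian h).
Proof.
rewrite /draconian subn1; apply: (iffP andP) => [[hT bound]|[hT bound]].
  split=> [|A A0]; first exact/eqP.
  pose S := [set J : neset n | val J \subset A].
  have AS : (Sub A A0 : neset n) \in S by rewrite inE /= subxx.
  have S0 : S != set0 by apply/set0Pn; exists (Sub A A0).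
  have /forallP/(_ S)/implyP/(_ S0) := bound.
  have -> : \bigcup_(J in S) val J = A.
    apply/setP => i; apply/bigcupP/idP => [[J]|iA].
      by rewrite inE => /subsetP; apply.
    by exists (Sub A A0).
  rewrite [X in (X <= _)%N](eq_bigl (fun J : neset n => val J \subset A)) => [|J]; last by rewrite inE.
  by rewrite leq_subRL ?card_gt0 // add1n.
split; first exact/eqP.
apply/forallP => S; apply/implyP => /set0Pn[J0 J0S].
have U0 : \bigcup_(J in S) val J != set0.
  have /set0Pn[i iJ0] := valP J0; apply/set0Pn; exists i; apply/bigcupP.
  by exists J0.
rewrite leq_subRL ?card_gt0 // add1n; apply: leq_ltn_trans (bound _ U0).
rewrite big_mkcond [leqRHS]big_mkcond; apply: leq_sum => J _; case: ifP => // JS.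
by rewrite (bigcup_sup J JS).
Qed.

(** An interior point has all coordinates positive, with sum 1 + |h| <= n; so only
    the all-ones vector can occur, and for it the facet inequalities are the
    draconian ones. *)
Lemma interior_count_small h : (wsize h < n)%N ->
  interior_count h = draconian h.
Proof.
move=> h_small; have [pts_uniq ptsE] := pointsP (hyper_fun (add_full h)).
pose one : 'rV[int]_n := const_mx 1.
have sum_one (A : {set 'I_n}) : coord_sum one A = #|A|%:Z.
  by rewrite /coord_sum (eq_bigr (fun=> 1)) ?sumr_const ?natz // => i _; rewrite mxE.
have int_one a : interior h a -> a = one.
  move=> /interiorP[aT lower].
  have a_ge1 i : 1 <= a 0 i.
    have i0 : [set i] != set0 by apply/set0Pn; exists i; rewrite inE.
    have := lower [set i] i0; rewrite /coord_sum big_set1.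
    by apply: le_trans; rewrite lez_nat.
  have : \sum_i (a 0 i - 1) <= 0.
    rewrite sumrB sumr_const card_ord subr_le0.
    have <- : coord_sum a setT = \sum_i a 0 i by apply: eq_bigl => i; rewrite inE.
    by rewrite aT natz lez_nat.
  have sub_ge0 i : 0 <= a 0 i - 1 by rewrite subr_ge0.
  move=> sum_le0; have : \sum_i (a 0 i - 1) == 0.
    by rewrite eq_le sum_le0 sumr_ge0.
  rewrite psumr_eq0 // => /allP sum0; apply/rowP => i; rewrite mxE.
  by apply/eqP; rewrite -subr_eq0; apply: sum0; rewrite mem_index_enum.
have one_draconian : interior h one = draconian h.
  apply/interiorP/draconianP; rewrite sum_one cardsT card_ord => -[hT bound].
    split=> [|A A0]; first by lia.
    by have := bound A A0; rewrite sum_one lez_nat.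
  split=> [|A A0]; first by rewrite hT prednK.
  by rewrite sum_one lez_nat; apply: bound.
rewrite -one_draconian /interior_count; case: (boolP (interior h one)) => [one_int|one_nint].
  rewrite (@eq_in_count _ _ (pred1 one)) => [|a a_pts]; last first.
    by apply/idP/eqP => [/int_one|->].
  have one_pts : one \in points (hyper_fun (add_full h)).
    by rewrite ptsE; case/andP: one_int.
  by rewrite count_uniq_mem // one_pts.
rewrite (@eq_in_count _ _ pred0) ?count_pred0 // => a a_pts.
by apply/negP => a_int; move: one_nint; rewrite -(int_one _ a_int) a_int.
Qed.

(** All coordinates of a point lie between 0 and the number of simplices, and
    one of them is determined by the others. *)
Lemma interior_count_growth h :
  (interior_count h <= (wsize h + 2) ^ n.-1)%N.
Proof.
have [pts_uniq ptsE] := pointsP (hyper_fun (add_full h)).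
pose M := (wsize h).+1.
have bounds a : a \in points (hyper_fun (add_full h)) ->
    (forall i, 0 <= a 0 i <= M%:Z) /\ coord_sum a setT = M%:Z.
  rewrite ptsE => /base_pointsP[af aT].
  have rankT : hyper_rank (add_full h) setT = M.
    by rewrite hyper_rank_add_full ?setT_neq0 // hyper_rankT.
  have rank_le A : (hyper_rank (add_full h) A <= M)%N.
    rewrite -rankT /hyper_rank big_mkcond [leqRHS]big_mkcond; apply: leq_sum => J _.
    by rewrite setIT (valP J); case: ifP.
  split=> [i|]; last by rewrite aT /hyper_fun rankT.
  have := af [set i]; have := af (~: [set i]); have := coord_sumUI a [set i] (~: [set i]).
  have -> : coord_sum a [set i] = a 0 i by rewrite /coord_sum big_set1.
  have a0 : coord_sum a set0 = 0 by rewrite /coord_sum big_set0.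
  rewrite setUCr setICr a0 aT /hyper_fun rankT.
  by have := rank_le [set i]; have := rank_le (~: [set i]); lia.
pose code (a : 'rV[int]_n) : {ffun 'I_n.-1 -> 'I_M.+1} :=
  [ffun i => inord (absz (a 0 (cast_ord (prednK n_gt0) (lift ord0 i))))].
have code_inj : {in points (hyper_fun (add_full h)) &, injective code}.
  move=> a c a_pts c_pts e; have [a_bd aT] := bounds a a_pts; have [c_bd cT] := bounds c c_pts.
  have eS i : a 0 (cast_ord (prednK n_gt0) (lift ord0 i)) =
              c 0 (cast_ord (prednK n_gt0) (lift ord0 i)).
    have := congr1 (fun g : {ffun _ -> _} => val (g i)) e; rewrite /= !ffunE /=.
    set k := cast_ord _ _; have /andP[c_ge0 cM] := c_bd k; have /andP[a_ge0 aM] := a_bd k.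
    have lt_M z : 0 <= z -> z <= M%:Z -> (`|z| < M.+1)%N.
      by move=> z_ge0 zM; rewrite ltnS -lez_nat gez0_abs.
    rewrite !inordK ?lt_M // => /(congr1 Posz).
    by rewrite !gez0_abs.
  have sumE (v : 'rV[int]_n) : coord_sum v setT = v 0 (cast_ord (prednK n_gt0) ord0) +
      \sum_(i < n.-1) v 0 (cast_ord (prednK n_gt0) (lift ord0 i)).
    rewrite -(big_ord_recl _ (fun i => v 0 (cast_ord (prednK n_gt0) i))).
    rewrite /coord_sum (reindex (cast_ord (prednK n_gt0))) /=; last first.
      by apply: onW_bij; exists (cast_ord (esym (prednK n_gt0))) => i; apply/val_inj.
    by apply: eq_bigl => i; rewrite inE.
  apply/rowP => i; rewrite -(cast_ordKV (prednK n_gt0) i).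
  case: (unliftP ord0 (cast_ord (esym (prednK n_gt0)) i)) => [j ->|->]; first exact: eS.
  move: aT; rewrite -cT !sumE (eq_bigr _ (fun j _ => eS j)); exact: addIr.
rewrite /interior_count (leq_trans (count_size _ _)) // -(size_map code).
have /card_uniqP <- : uniq (map code (points (hyper_fun (add_full h)))).
  by rewrite map_inj_in_uniq.
rewrite (leq_trans (max_card _)) // card_ffun !card_ord.
by rewrite /M -addn2.
Qed.

Lemma dragon_add_full h :
  dragon (fun J => (add_full h J)%:R : rat^o) =
  \sum_(g : {ffun neset n -> 'I_n} | draconian (fun J => g J)) \prod_(J : neset n) ('C(h J, g J))%:R.
Proof.
apply: eq_bigr => g _; rewrite [RHS](bigID (fun J : neset n => val J == setT)) /=.
congr (_ * _); apply: eq_bigr => J; rewrite full_setE /add_full /bump_at -gbinom_nat.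
  by move=> /eqP ->; rewrite eqxx natrD addrK.
by move/negbTE->; rewrite addn0.
Qed.

(** A draconian g has total n - 1, at least that of h; so a nonzero product of
    binomials, which needs g <= h, forces g = h. *)
Lemma dragon_small h : (wsize h < n)%N ->
  dragon (fun J => (add_full h J)%:R : rat^o) = (draconian h)%:R.
Proof.
move=> h_small; rewrite dragon_add_full.
have h_lt J : (h J < n)%N.
  by apply: leq_ltn_trans h_small; rewrite /wsize (bigD1 J) //= leq_addr.
pose g0 : {ffun neset n -> 'I_n} := [ffun J => Ordinal (h_lt J)].
have g0E J : g0 J = h J :> nat by rewrite ffunE.
have drac0 : draconian (fun J => g0 J) = draconian h.
  by congr draconian; apply/funext.
have other g : draconian (fun J => g J) -> g != g0 ->
    \prod_(J : neset n) ('C(h J, g J))%:R = 0 :> rat^o.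
  move=> /draconianP[gT _] g_neq.
  have [J hg] : exists J, (h J < g J)%N.
    apply/existsP; apply: contraT; rewrite negb_exists => /forallP le_gh.
    case/eqP: g_neq; apply/ffunP => J; apply/val_inj; rewrite /= g0E.
    have {}le_gh K : (g K <= h K)%N by have := le_gh K; rewrite -leqNgt.
    apply/eqP; rewrite eqn_leq le_gh /=; rewrite leqNgt; apply/negP => lt_gh.
    suff : (wsize (fun J => g J) < wsize h)%N.
      by rewrite gT ltnNge => /negP; apply; rewrite -ltnS prednK.
    rewrite /wsize (bigD1 J) //= [ltnRHS](bigD1 J) //= -addSn leq_add //.
    by apply: leq_sum => K _.
  by rewrite (bigD1 J) //= bin_small // mul0r.
case: (boolP (draconian h)) => h_drac.
  rewrite (bigD1 g0) ?drac0 //= [X in _ + X]big1 => [|g /andP[]]; last exact: other.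
  by rewrite addr0 big1 // => J _; rewrite g0E binn.
rewrite big1 // => g g_drac; apply: other => //.
by apply: contraTneq g_drac => ->; rewrite drac0.
Qed.

Lemma dragon_growth h :
  `|dragon (fun J => (add_full h J)%:R : rat^o) : rat| <=
  #|{ffun neset n -> 'I_n}|%:R * (wsize h + 2)%:R ^+ n.-1.
Proof.
rewrite dragon_add_full ger0_norm; last first.
  by apply: sumr_ge0 => g _; apply: prodr_ge0 => J _; rewrite ler0n.
rewrite mulr_natl -sumr_const big_mkcond /=; apply: ler_sum => g _.
case: ifP => [/draconianP[gT _]|_]; last by rewrite exprn_ge0 ?ler0n.
rewrite -gT /wsize -prodrXr; apply: ler_prod => J _; rewrite ler0n /= -natrX ler_nat.
apply: (@leq_trans (h J ^ g J)).
  rewrite -(leq_pmul2r (fact_gt0 (g J))) bin_ffact.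
  apply: (@leq_trans (h J ^ g J)); last by rewrite leq_pmulr ?fact_gt0.
  elim: (g J : nat) => [|k IHk]; first by rewrite ffactn0.
  by rewrite ffactnSr expnSr leq_mul // leq_subr.
have h_le : (h J <= \sum_K h K + 2)%N by rewrite (bigD1 J) //= -addnA leq_addr.
by case: (g J : nat) => [|k]; rewrite ?expn0 // leq_exp2r.
Qed.

End Interior.

Section TutteAtZero.
Variables (n : nat) (n_gt0 : (0 < n)%N).
Variables (T : tutte_ring n) (T_univ : universal_tutte T).

Let tutte_zero (t : neset n -> nat) : rat :=
  (set_subst (@z_of_t n) T).@[eval_at 0 0 (fun J => (t J)%:R)].

Let dragonq (t : neset n -> nat) : rat := dragon (fun J => (t J)%:R : rat^o).

Lemma polyfun_tutte_zero : polyfun tutte_zero.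
Proof.
apply: polyfun_meval => i; rewrite /eval_at; case: (enum_val i) => [k|J].
  exact: polyfun_const.
exact: polyfun_coord.
Qed.

Lemma polyfun_dragon : polyfun dragonq.
Proof.
have gbinom_poly c (J : neset n) k :
    polyfun (fun t : neset n -> nat => (gbinom ((t J)%:R - c : rat^o) k : rat)).
  rewrite /gbinom; apply: (@polyfunM _ (fun=> k`!%:R^-1)); first exact: polyfun_const.
  apply: polyfun_prod => i.
  under [X in polyfun X]funext do rewrite -addrA -opprD.
  by apply: polyfunD; [exact: polyfun_coord | exact: polyfun_const].
rewrite /dragonq /dragon; apply: polyfun_sum => g; apply: polyfunM.
  by apply: polyfun_prod => J; apply: gbinom_poly.
apply: polyfun_prod => J.
by under [X in polyfun X]funext do rewrite -[X in gbinom X]subr0; apply: gbinom_poly.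
Qed.

(** Both sides are polynomials of degree at most n - 1 when the full simplex
    occurs at least once, since they grow no faster than that; so it suffices to
    compare them when at most n - 1 other simplices occur. *)
Lemma tutte_zero_dragon (t : neset n -> nat) : tutte_zero t = - dragonq t.
Proof.
apply/eqP; rewrite -addr_eq0; apply/eqP; move: t.
have sum_poly : polyfun (fun t => tutte_zero t + dragonq t).
  exact: polyfunD polyfun_tutte_zero polyfun_dragon.
apply: (polyfun_vanish_ge sum_poly (c := 1)) => t t_ge1.
have -> : t = add_full n_gt0 (fun J => t J - (J == full_set n_gt0))%N.
  apply/funext => J; rewrite /add_full /bump_at mul1n subnK //.
  by case: (_ == _).
move: (fun J => _) => {t t_ge1} h.
pose G h := tutte_zero (add_full n_gt0 h) + dragonq (add_full n_gt0 h).
have tutte_zeroE u : tutte_zero (add_full n_gt0 u) = - (interior_count n_gt0 u)%:R.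
  by rewrite /tutte_zero meval_universal // tutte00_add_full.
have G_poly : polyfun G.
  have [d sum_lt] := sum_poly; exists d; apply: deg_lt_shift sum_lt.
suff G_lt : deg_lt n.-1.+1 G.
  apply: (deg_lt_vanish_simplex G_lt) => u; rewrite prednK // => u_small.
  by rewrite /G tutte_zeroE interior_count_small // /dragonq dragon_small // addNr.
apply: (polyfun_growth (C := 1 + #|{ffun neset n -> 'I_n}|%:R) G_poly) => u.
rewrite /G tutte_zeroE (le_trans (ler_normD _ _)) // mulrDl mul1r lerD //; last first.
  exact: dragon_growth.
by rewrite normrN ger0_norm ?ler0n // -natrX ler_nat interior_count_growth.
Qed.

End TutteAtZero.

(** * Faces of a generic sum of simplices *)

Section Faces.
Variables (n l : nat) (B : l.-tuple {set 'I_n}).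
Hypothesis B_osp : ord_set_partition B.

Definition block_index (i : 'I_n) : nat := find (fun A : {set 'I_n} => i \in A) B.

Lemma mem_block (k : 'I_l) i : (i \in tnth B k) = (block_index i == k).
Proof.
have /and3P[_ /forallP disj _] := B_osp.
have [k_lt kE] : (k < size B)%N /\ nth set0 B k = tnth B k.
  by rewrite size_tuple ltn_ord -tnth_nth.
apply/idP/eqP => [ik|e].
  have lt_idx : (block_index i < l)%N.
    by rewrite /block_index -[X in (_ < X)%N](size_tuple B) -has_find; apply/hasP;
       exists (tnth B k); rewrite ?mem_tnth.
  pose k' := Ordinal lt_idx.
  have ik' : i \in tnth B k'.
    rewrite (tnth_nth set0) /=; apply: (@nth_find _ set0 (fun A : {set 'I_n} => i \in A)).
    by rewrite has_find size_tuple.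
  suff -> : k = k' by [].
  apply/eqP; apply: contraT => kk'.
  have /forallP/(_ k')/implyP/(_ kk') := disj k.
  by rewrite disjoint_subset => /subsetP/(_ i ik); rewrite inE ik'.
rewrite -kE -e; apply: (@nth_find _ set0 (fun A : {set 'I_n} => i \in A)).
by rewrite has_find -/(block_index i) e.
Qed.

Lemma block_index_lt i : (block_index i < l)%N.
Proof.
have /and3P[_ _ /eqP cover] := B_osp.
have : i \in \bigcup_(k < l) tnth B k by rewrite cover inE.
by case/bigcupP => k _; rewrite mem_block => /eqP->.
Qed.

Lemma block_index_surj k : (k < l)%N -> exists i, block_index i = k.
Proof.
move=> k_lt; have /and3P[/forallP/(_ (Ordinal k_lt))/set0Pn[i]] := B_osp.
by rewrite mem_block => /eqP e; exists i.
Qed.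

Lemma mem_blocks (P : pred 'I_l) i :
  (i \in \bigcup_(j < l | P j) tnth B j) = P (Ordinal (block_index_lt i)).
Proof.
apply/bigcupP/idP => [[j Pj]|Pi].
  by rewrite mem_block => /eqP e; rewrite (_ : Ordinal _ = j) //; apply/val_inj.
by exists (Ordinal (block_index_lt i)); rewrite // mem_block.
Qed.

Definition before : rel 'I_n := fun i j => (block_index i <= block_index j)%N.

(** The face of the simplex on J where a linear form increasing with the block
    index is maximal. *)
Definition top_face (J : {set 'I_n}) : {set 'I_n} :=
  [set i in J | [forall j in J, before j i]].

Lemma top_faceP (J : {set 'I_n}) i :
  reflect (i \in J /\ forall j, j \in J -> before j i) (i \in top_face J).
Proof. by rewrite inE; apply: (iffP andP) => -[iJ /forall_inP]. Qed.

Lemma top_face_neq0 (J : {set 'I_n}) : J != set0 -> top_face J != set0.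
Proof.
case/set0Pn => i iJ; case: (@arg_maxnP _ i (mem J) block_index iJ) => m mJ m_max.
by apply/set0Pn; exists m; apply/top_faceP; split=> // j /m_max.
Qed.

Variable t : neset n -> nat.

Let u : neset n -> nat := block_param B t.

(** The sets J with top face A are the unions of A with sets of elements of
    earlier blocks. *)
Lemma block_paramE (A : neset n) :
  u A = (\sum_(J : neset n | top_face (val J) == val A) t J)%N.
Proof.
have [a aA] := set0Pn _ (valP A).
rewrite /u /block_param; case: pickP => [k /subsetP Ak|noblock]; last first.
  rewrite big1 // => J /eqP topJ; have := noblock (Ordinal (block_index_lt a)).
  move/negP; case; apply/subsetP => i iA; rewrite mem_block /= eqn_leq.
  move: aA iA; rewrite -topJ => /top_faceP[aJ a_max] /top_faceP[iJ i_max].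
  by rewrite [X in X && _]a_max // [X in _ && X]i_max.
have idxA i : i \in val A -> block_index i = k by move/Ak; rewrite mem_block => /eqP.
rewrite [RHS](reindex_onto (neset_union A) (fun J => val J :\: val A)) /=; last first.
  move=> J /eqP topJ; apply/val_inj; rewrite /= setDE setUIr setUCr setIT.
  by apply/setUidPr; rewrite -topJ; apply/subsetP => i /top_faceP[].
apply: eq_bigl => X; apply/subsetP/andP => [X_before|[/eqP topX /eqP X_disj] i iX].
  have X_lt i : i \in X -> (block_index i < k)%N.
    by move/X_before; rewrite mem_blocks.
  split; apply/eqP/setP => i; last first.
    rewrite !inE; case iA: (i \in val A) => //=; symmetry.
    by apply/negP => /X_lt; rewrite idxA // ltnn.
  apply/top_faceP/idP => [[]|iA].
    rewrite inE => /orP[//|/X_lt i_lt] /(_ a); rewrite inE aA => /(_ isT).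
    by rewrite /before idxA // leqNgt i_lt.
  split=> [|j]; rewrite inE ?iA // /before (idxA i iA) => /orP[/idxA-> //|/X_lt].
  exact: ltnW.
have {}topX : top_face (val A :|: X) = val A := topX.
have iAX : i \in val A :|: X by rewrite inE iX orbT.
have a_top : a \in top_face (val A :|: X) by rewrite topX.
have iA : i \notin val A by move: iX; rewrite -X_disj inE => /andP[].
rewrite mem_blocks /= ltn_neqAle -(idxA a aA).
have /top_faceP[_ a_max] := a_top.
rewrite [X in _ && X]a_max // andbT; apply: contra iA => /eqP e.
by rewrite -topX; apply/top_faceP; split=> // j /a_max; rewrite /before e.
Qed.

Definition top_neset (J : neset n) : neset n :=
  Sub (top_face (val J)) (top_face_neq0 (valP J)).

Lemma face_rankE (A : {set 'I_n}) :
  hyper_rank u A = (\sum_(J : neset n | top_face (val J) :&: A != set0) t J)%N.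
Proof.
rewrite /hyper_rank [RHS](partition_big top_neset (fun J : neset n => val J :&: A != set0)) //=.
apply: eq_bigr => J J_meets; rewrite block_paramE; apply: eq_bigl => K.
have -> : (top_neset K == J) = (top_face (val K) == val J) by rewrite -(inj_eq val_inj).
case: eqP => [topK|]; last by rewrite andbF.
by rewrite andbT; symmetry; move: J_meets; rewrite -topK.
Qed.

Lemma face_rankE_sum (A : {set 'I_n}) :
  hyper_rank u A = (\sum_(J : neset n) (top_face (val J) :&: A != set0) * t J)%N.
Proof.
by rewrite face_rankE big_mkcond; apply: eq_bigr => J _; case: ifP; rewrite ?mul1n.
Qed.

Lemma face_rank_le A : (hyper_rank u A <= hyper_rank t A)%N.
Proof.
rewrite face_rankE_sum hyper_rankE; apply: leq_sum => J _.
case: (set_meetsP (top_face (val J)) A) => // -[i [/top_faceP[iJ _] iA]].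
by case: set_meetsP => // -[]; exists i.
Qed.

Lemma face_rank_closed A : rclosed before A -> hyper_rank u A = hyper_rank t A.
Proof.
move/rclosedP => A_closed; rewrite face_rankE_sum hyper_rankE; apply: eq_bigr => J _.
congr (nat_of_bool _ * _)%N; apply/set_meetsP/set_meetsP => -[i [iJ iA]].
  by exists i; split=> //; case/top_faceP: iJ.
have /set0Pn[j j_top] := top_face_neq0 (valP J).
exists j; split=> //; apply: A_closed iA _; case/top_faceP: j_top => _.
exact.
Qed.

Lemma block_param_supp (A : neset n) : (0 < u A)%N ->
  {in val A &, forall i j, block_index i = block_index j}.
Proof.
rewrite block_paramE lt0n sum_nat_eq0 negb_forall_in => /exists_inP[J /eqP topJ _] i j.
rewrite -topJ => /top_faceP[iJ i_max] /top_faceP[jJ j_max].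
by apply/eqP; rewrite eqn_leq [X in X && _]j_max // [X in _ && X]i_max.
Qed.

Hypothesis t_gt0 : forall J, (0 < t J)%N.

Lemma block_param_full i : exists2 A : neset n, (0 < u A)%N &
  forall j, block_index j = block_index i -> j \in val A.
Proof.
have A0 : [set j | block_index j == block_index i] != set0.
  by apply/set0Pn; exists i; rewrite inE.
pose A : neset n := Sub [set j | block_index j == block_index i] A0.
exists A => [|j e]; last by rewrite inE e.
rewrite block_paramE (bigD1 A) ?addn_gt0 ?t_gt0 //=.
apply/eqP/setP => j; apply/top_faceP/idP => [[] //|jA]; split=> // k.
by move: jA; rewrite !inE /before => /eqP-> /eqP->.
Qed.

(** Two elements in different blocks span a simplex whose top face is the later
    of them. *)
Lemma face_rank_eq_later A i j : hyper_rank u A = hyper_rank t A ->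
  i \in A -> (block_index i < block_index j)%N -> j \in A.
Proof.
move=> rankE iA ij; apply: contraT => jA.
have J0 : [set i; j] != set0 by apply/set0Pn; exists i; rewrite !inE eqxx.
pose K : neset n := Sub [set i; j] J0.
suff : (hyper_rank u A < hyper_rank t A)%N by rewrite rankE ltnn.
rewrite face_rankE_sum hyper_rankE (bigD1 K) //= [ltnRHS](bigD1 K) //=.
have -> : [set i; j] :&: A != set0 by apply/set_meetsP; exists i; rewrite !inE eqxx.
have -> : (top_face [set i; j] :&: A != set0) = false.
  apply/set_meetsP => -[k [/top_faceP[]]]; rewrite !inE => /orP[] /eqP->.
    by move=> /(_ j); rewrite !inE eqxx orbT /before leqNgt ij => /(_ isT).
  by move=> _; rewrite (negbTE jA).
rewrite mul0n mul1n -addSn leq_add ?t_gt0 //; apply: leq_sum => J _.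
rewrite leq_mul2r; apply/orP; right.
case: (set_meetsP (top_face (val J)) A) => // -[k [/top_faceP[kJ _] kA]].
by case: set_meetsP => // -[]; exists k.
Qed.

Let in_block (k : 'I_l) (A : {set 'I_n}) := [set i in A | block_index i == k].
Let after (k : 'I_l) := [set i | (k < block_index i)%N].

Lemma coord_sum_blocks a A : coord_sum a A = \sum_(k < l) coord_sum a (in_block k A).
Proof.
rewrite /coord_sum (partition_big (fun i => Ordinal (block_index_lt i)) xpredT) //=.
by apply: eq_bigr => k _; apply: eq_bigl => i; rewrite inE.
Qed.

Lemma face_rank_blocks A : hyper_rank u A = (\sum_(k < l) hyper_rank u (in_block k A))%N.
Proof.
under [RHS]eq_bigr do rewrite face_rankE_sum.
rewrite face_rankE_sum exchange_big /=; apply: eq_bigr => J _.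
rewrite -big_distrl /=; congr (_ * _)%N.
case: (set_meetsP (top_face (val J)) A) => [[i [iJ iA]]|no_meet]; last first.
  rewrite big1 // => k _; case: set_meetsP => // -[i [iJ]]; rewrite inE => /andP[iA _].
  by case: no_meet; exists i.
rewrite (bigD1 (Ordinal (block_index_lt i))) //= big1 ?addn0 => [|k k_neq].
  by case: set_meetsP => // -[]; exists i; split; rewrite // inE iA eqxx.
case: set_meetsP => // -[j [/top_faceP[jJ j_max]]]; rewrite inE => /andP[_ jk].
case/top_faceP: iJ => iJ i_max; case/eqP: k_neq; apply/val_inj => /=.
by rewrite -(eqP jk); apply/eqP; rewrite eqn_leq [X in X && _]i_max // [X in _ && X]j_max.
Qed.

Lemma face_rank_block k A :
  (hyper_rank u (in_block k A) + hyper_rank t (after k) =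
   hyper_rank t (in_block k A :|: after k))%N.
Proof.
rewrite face_rankE_sum !hyper_rankE -big_split /=; apply: eq_bigr => J _.
rewrite -mulnDl set_meetsU; congr (_ * _)%N.
case: (set_meetsP (val J) (after k)) => [[i [iJ]]|no_after].
  rewrite inE => ki; rewrite orbT; case: set_meetsP => // -[j [/top_faceP[_ j_max]]].
  by rewrite inE => /andP[_ /eqP jk]; have := j_max i iJ; rewrite /before jk leqNgt ki.
rewrite orbF addn0; congr nat_of_bool; apply/set_meetsP/set_meetsP => -[i [iJ ik]].
  by exists i; split=> //; case/top_faceP: iJ.
exists i; split=> //; apply/top_faceP; split=> // j jJ.
move: ik; rewrite inE => /andP[_ /eqP ik]; rewrite /before ik leqNgt.
by apply/negP => kj; case: no_after; exists j; rewrite inE.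
Qed.

Lemma rclosed_after k : rclosed before (after k).
Proof. by apply/rclosedP => i j; rewrite !inE => ki; apply: leq_trans. Qed.

Lemma rclosed_blocks A :
  [forall k, rclosed before (in_block k A :|: after k)] =
  rclosed (same_block block_index) A.
Proof.
apply/forallP/rclosedP => [A_cl i j iA /eqP bij|A_sat k].
  have /rclosedP/(_ i j) := A_cl (Ordinal (block_index_lt i)).
  rewrite !inE /= iA eqxx /before -bij ltnn leqnn eqxx !andbT orbF.
  by move=> /(_ isT isT); rewrite orbF.
apply/rclosedP => i j; rewrite !inE /before => /orP[/andP[iA /eqP ik]|ki] ij; last first.
  by rewrite (leq_trans ki ij) orbT.
move: ij; rewrite ik leq_eqVlt => /orP[/eqP kj|->]; last by rewrite orbT.
by rewrite (A_sat i) //= -?kj ?eqxx // /same_block ik kj.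
Qed.

(** The sum over the final blocks is tight, so the bound of the sum on the part of
    A in block k together with all later blocks becomes the bound of the face on
    that part; adding over k gives the bound of the face on A.  Conversely the
    bounds of the face are stronger, and by face_rank_eq_later they can be equal to
    those of the sum only on unions of final blocks. *)
Lemma cell_face a :
  cell (hyper_fun t) before a = cell (hyper_fun u) (same_block block_index) a.
Proof.
have before_T : rclosed before setT by apply/rclosedP => i j; rewrite !inE.
have rankT : hyper_rank u setT = hyper_rank t setT := face_rank_closed before_T.
apply/andP/andP => -[/base_pointsP[af aT] /forallP tightE].
  have block_leif k A : coord_sum a (in_block k A) <= hyper_fun u (in_block k A)
      ?= iff rclosed before (in_block k A :|: after k).
    have := face_rank_block k A; have := coord_sumUI a (in_block k A) (after k).
    have -> : in_block k A :&: after k = set0.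
      apply/setP => i; rewrite !inE; case: eqP => [->|]; last by rewrite andbF.
      by rewrite ltnn andbF.
    have a0 : coord_sum a set0 = 0 by rewrite /coord_sum big_set0.
    have := tightE (after k); rewrite rclosed_after => /eqP/eqP.
    have := tightE (in_block k A :|: after k) => /eqP <-.
    have := af (in_block k A :|: after k).
    rewrite a0 /tight /hyper_fun => sum_le sum_after sumE rankE; split; first by lia.
    by apply/eqP/eqP => ?; lia.
  have A_leif A : coord_sum a A <= hyper_fun u A ?= iff rclosed (same_block block_index) A.
    rewrite coord_sum_blocks /hyper_fun face_rank_blocks -rclosed_blocks.
    rewrite (raddf_sum (GRing.RMorphism.clone _ _ Posz _)).
    by apply: leif_sum => k _; apply: block_leif.
  split; first by apply/base_pointsP; split=> [A|]; [exact: A_leif | rewrite aT /hyper_fun rankT].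
  by apply/forallP => A; rewrite /tight (A_leif A).2.
split.
  apply/base_pointsP; split=> [A|]; last by rewrite aT /hyper_fun rankT.
  by rewrite (le_trans (af A)) // lez_nat face_rank_le.
apply/forallP => A; apply/eqP; apply/idP/idP => [At|A_closed]; last first.
  rewrite /tight /hyper_fun -face_rank_closed //; have := tightE A.
  suff -> : rclosed (same_block block_index) A by move/eqP.
  apply/rclosedP => i j iA /eqP bij; move/rclosedP: A_closed; apply; first exact: iA.
  by rewrite /before bij.
have rankE : hyper_rank u A = hyper_rank t A.
  have := af A; have := face_rank_le A; move/eqP: At; rewrite /hyper_fun; lia.
have : tight (hyper_fun u) a A by rewrite /tight /hyper_fun rankE.
rewrite (eqP (tightE A)) => /rclosedP A_sat; apply/rclosedP => i j iA.
rewrite /before leq_eqVlt => /orP[bij|]; first exact: A_sat iA bij.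
exact: face_rank_eq_later.
Qed.

End Faces.

Section BlockMinima.
Variables (n l : nat) (B : l.-tuple {set 'I_n}).
Hypothesis B_osp : ord_set_partition B.

Lemma before_refl : reflexive (before B).
Proof. by move=> i; apply: leqnn. Qed.

Lemma before_trans : transitive (before B).
Proof. by move=> j i k; apply: leq_trans. Qed.

Lemma lr_minE : lr_min B = #|label_min (before B)|.
Proof.
apply: eq_card => m; rewrite inE; apply/existsP/label_minP => [[k /andP[]]|m_min].
  rewrite (mem_blocks B_osp) /= => mk /forall_inP m_le j; apply: contraTN => jm.
  by rewrite -leqNgt m_le // (mem_blocks B_osp) /= (leq_trans jm).
exists (Ordinal (block_index_lt B_osp m)); apply/andP; split.
  by rewrite (mem_blocks B_osp) /=.
apply/forall_inP => j; rewrite (mem_blocks B_osp) /= => jm.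
by rewrite leqNgt; apply/negP => /m_min; rewrite /before jm.
Qed.

Lemma rl_minE : rl_min B = #|label_min (fun i j => before B j i)|.
Proof.
apply: eq_card => m; rewrite inE; apply/existsP/label_minP => [[k /andP[]]|m_min].
  rewrite (mem_blocks B_osp) /= => mk /forall_inP m_le j; apply: contraTN => jm.
  by rewrite -leqNgt m_le // (mem_blocks B_osp) /= (leq_trans mk).
exists (Ordinal (block_index_lt B_osp m)); apply/andP; split.
  by rewrite (mem_blocks B_osp) /=.
apply/forall_inP => j; rewrite (mem_blocks B_osp) /= => jm.
by rewrite leqNgt; apply/negP => /m_min; rewrite /before jm.
Qed.

(** Any two indices are comparable, so the first index is the only minimum on
    both sides. *)
Lemma label_minI_before (n_gt0 : (0 < n)%N) :
  label_min (before B) :&: label_min (fun i j => before B j i) = [set Ordinal n_gt0].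
Proof.
apply/setP => i; rewrite in_setI in_set1; apply/andP/eqP => [[/label_minP lr /label_minP rl]|->].
  apply/val_inj => /=; case: (posnP i) => // i_gt0.
  have := lr (Ordinal n_gt0) i_gt0; have := rl (Ordinal n_gt0) i_gt0.
  by rewrite /before; case: leqP => // /ltnW ->.
by split; apply/label_minP.
Qed.

Lemma tutte_term_cell (n_gt0 : (0 < n)%N) f a (R : comNzRingType) (x y : R) :
  cell f (before B) a ->
  x ^+ #|int_active (base_points f) a :\: ext_active (base_points f) a| *
  y ^+ #|ext_active (base_points f) a :\: int_active (base_points f) a| *
  (x + y - 1) ^+ #|int_active (base_points f) a :&: ext_active (base_points f) a| =
  (x + y - 1) * (x ^+ (lr_min B - 1) * y ^+ (rl_min B - 1)).
Proof.
move=> a_cell; rewrite (int_active_cell before_refl before_trans a_cell).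
rewrite (ext_active_cell before_refl before_trans a_cell) mulrC lr_minE rl_minE.
have := label_minI_before n_gt0; set I := label_min _; set E := label_min _ => IE.
by rewrite !cardsD [E :&: I]setIC IE cards1 expr1.
Qed.

End BlockMinima.

(** * Total preorders and ordered set partitions *)

Section Preorders.
Variable n : nat.

(** The number of elements strictly below i orders the indices as r does; the
    blocks are its level sets, taken in increasing order. *)
Lemma exists_ord_set_partition (r : rel 'I_n) :
  reflexive r -> transitive r -> total r ->
  exists l, (l < n.+1)%N /\
    exists2 B : l.-tuple {set 'I_n}, ord_set_partition B & r = before B.
Proof.
move=> r_refl r_trans r_total.
pose score i := #|[set j | ~~ r i j]|.
have scoreE i j : r i j = (score i <= score j)%N.
  case: (boolP (r i j)) => rij.
    symmetry; apply/subset_leq_card/subsetP => k; rewrite !inE; apply: contra.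
    exact: r_trans.
  symmetry; apply/negbTE; rewrite -ltnNge; apply/proper_card/properP; split.
    apply/subsetP => k; rewrite !inE => rjk; apply: contra rij => rik.
    by apply: r_trans rik _; case/orP: (r_total j k) rjk => ->.
  by exists j; rewrite !inE ?r_refl.
pose vals := sort leq (undup (map score (enum 'I_n))).
have vals_uniq : uniq vals by rewrite sort_uniq undup_uniq.
have score_vals i : score i \in vals.
  by rewrite mem_sort mem_undup map_f ?mem_enum.
have vals_sorted : sorted ltn vals.
  by rewrite ltn_sorted_uniq_leq vals_uniq sort_sorted //; apply: leq_total.
pose B : (size vals).-tuple {set 'I_n} :=
  map_tuple (fun v => [set i | score i == v]) (in_tuple vals).
exists (size vals); split.
  rewrite ltnS size_sort (leq_trans (size_undup _)) // size_map.
  by rewrite -cardE card_ord.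
have tnthB k i : (i \in tnth B k) = (score i == nth 0%N vals k).
  by rewrite (tnth_nth set0) (nth_map 0%N) ?inE // -[X in (_ < X)%N]size_tuple.
have idx_lt i : (index (score i) vals < size vals)%N by rewrite index_mem.
exists B.
  apply/and3P; split.
  - apply/forallP => k; have k_lt : (k < size vals)%N := ltn_ord k.
    have := mem_nth 0%N k_lt; rewrite mem_sort mem_undup => /mapP[i _ e].
    by apply/set0Pn; exists i; rewrite tnthB e.
  - apply/forallP => j; apply/forallP => k; apply/implyP => jk.
    rewrite disjoint_subset; apply/subsetP => i; rewrite inE !tnthB => /eqP->.
    by rewrite nth_uniq // ltn_ord.
  apply/eqP/setP => i; rewrite inE; apply/bigcupP.
  by exists (Ordinal (idx_lt i)); rewrite // tnthB nth_index.
apply/funext => i; apply/funext => j; rewrite scoreE /before /block_index /= !find_map.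
have findE k : find (preim (fun v => [set i | score i == v]) (fun A : {set 'I_n} => k \in A)) vals =
    index (score k) vals.
  by apply: eq_find => v /=; rewrite inE eq_sym.
rewrite !findE; apply/idP/idP => [le_score|]; last first.
  apply: (sorted_leq_index leq_trans leqnn) => //; rewrite sort_sorted //.
  exact: leq_total.
rewrite leqNgt; apply/negP => /(sorted_ltn_index ltn_trans vals_sorted).
by rewrite /= !score_vals ltnNge le_score => /(_ isT isT).
Qed.

(** By induction on the index: the preceding block of B, being nonempty, has an
    element strictly before i for B' too. *)
Lemma block_index_le l l' (B : l.-tuple {set 'I_n}) (B' : l'.-tuple {set 'I_n}) :
  ord_set_partition B -> before B = before B' ->
  forall i, (block_index B i <= block_index B' i)%N.
Proof.
move=> B_osp eBB' i; move: {2}(block_index B i) (leqnn (block_index B i)) => k.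
elim: k i => [|k IHk] i; first by rewrite leqn0 => /eqP->.
rewrite leq_eqVlt => /orP[/eqP e|]; last by rewrite ltnS; apply: IHk.
have [j jk] : exists j, block_index B j = k.
  by apply: (block_index_surj B_osp); apply: ltn_trans (block_index_lt B_osp i); rewrite e.
have : ~~ before B i j by rewrite /before e jk ltnn.
rewrite eBB' /before -ltnNge e; apply: leq_ltn_trans.
by rewrite -jk; apply: IHk; rewrite jk.
Qed.

Lemma before_inj_size l l' (B : l.-tuple {set 'I_n}) (B' : l'.-tuple {set 'I_n}) :
  ord_set_partition B -> ord_set_partition B' -> before B = before B' -> (l <= l')%N.
Proof.
move=> B_osp B'_osp eBB'; case: l B B_osp eBB' => // l B B_osp eBB'.
have [i <-] := block_index_surj B_osp (ltnSn l).
exact: leq_ltn_trans (block_index_le B_osp eBB' i) (block_index_lt B'_osp i).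
Qed.

Lemma before_inj l (B B' : l.-tuple {set 'I_n}) :
  ord_set_partition B -> ord_set_partition B' -> before B = before B' -> B = B'.
Proof.
move=> B_osp B'_osp eBB'; apply/eq_from_tnth => k; apply/setP => i.
rewrite !mem_block //; congr (_ == _); apply/eqP; rewrite eqn_leq.
by rewrite (block_index_le B_osp eBB') (block_index_le B'_osp (esym eBB')).
Qed.

End Preorders.

Section GenericSum.
Variables (n : nat) (n_gt0 : (0 < n)%N) (t : neset n -> nat).
Hypothesis t_gt0 : forall J, (0 < t J)%N.

(** Two incomparable tight sets would be separated by an edge in the sum, making
    the submodular inequality strict on them; so the tight sets form a chain. *)
Lemma exchange_rel_total a : base_points (hyper_fun t) a ->
  total (exchange_rel (hyper_fun t) a).
Proof.
move=> /base_pointsP[af _] i j; apply/orP; apply/orP; rewrite -implyNb; apply/implyP.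
rewrite negb_forall => /existsP[A]; rewrite negb_imply => /andP[/andP[/eqP At iA] jA].
apply/exchange_relP => A' /eqP A't jA'; apply: contraT => iA'.
have J0 : [set i; j] != set0 by apply/set0Pn; exists i; rewrite !inE eqxx.
pose K : neset n := Sub [set i; j] J0.
suff : (hyper_rank t (A :&: A') + hyper_rank t (A :|: A') <
    hyper_rank t A + hyper_rank t A')%N.
  have := coord_sumUI a A A'; have := af (A :|: A'); have := af (A :&: A').
  by rewrite At A't /hyper_fun; lia.
have K_both : (val K :&: A != set0) && (val K :&: A' != set0).
  by apply/andP; split; apply/set_meetsP; [exists i | exists j]; rewrite !inE eqxx ?orbT.
rewrite (hyper_rankU t A A') addnC ltn_add2l (bigD1 K) //= -add1n.
apply: leq_add; first exact: t_gt0.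
rewrite /hyper_rank big_mkcond [leqRHS]big_mkcond; apply: leq_sum => J _.
case: set_meetsP => // -[k [kJ]]; rewrite inE => /andP[kA kA'].
have -> : val J :&: A != set0 by apply/set_meetsP; exists k.
have -> : val J :&: A' != set0 by apply/set_meetsP; exists k.
case: eqP => // eJK; move: kJ; rewrite eJK !inE => /orP[] /eqP e.
  by rewrite -e kA' in iA'.
by rewrite -e kA in jA.
Qed.

(** Exactly one ordered set partition has as its order the total exchange relation
    of a given point, so the points are distributed among the faces. *)
Lemma tutte_generic (R : comNzRingType) (x y : R) :
  tutte (base_points (hyper_fun t)) x y =
  (x + y - 1) * \sum_(l < n.+1) \sum_(B : l.-tuple {set 'I_n} | ord_set_partition B)
    (count (cell (hyper_fun t) (before B)) (points (hyper_fun t)))%:R *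
    (x ^+ (lr_min B - 1) * y ^+ (rl_min B - 1)).
Proof.
pose wt l (B : l.-tuple {set 'I_n}) : R := x ^+ (lr_min B - 1) * y ^+ (rl_min B - 1).
rewrite tutteE big_distrr /=.
under [RHS]eq_bigr => l _.
  rewrite big_distrr /=.
  under eq_bigr => B _.
    rewrite -/(wt l B) mulrA [_ * _%:R]mulrC -mulrA mulr_natl -iter_addr_0 -big_const_seq.
    rewrite big_mkcond; over.
  rewrite exchange_big /=; over.
rewrite exchange_big /= big_seq [RHS]big_seq; apply: eq_bigr => a.
have [_ ptsE] := pointsP (hyper_fun t); rewrite ptsE => aP.
have a_cell := cell_exchange_rel (hyper_fun_submodular t) aP.
have [l [l_lt [B B_osp rE]]] := exists_ord_set_partition
  (@exchange_rel_refl _ _ a) (@exchange_rel_trans _ _ a) (exchange_rel_total aP).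
rewrite rE in a_cell.
have cell_inj l' (B' : l'.-tuple {set 'I_n}) : cell (hyper_fun t) (before B') a ->
    before B' = before B.
  move=> a_cell'; rewrite -rE; apply/funext => i; apply/funext => j.
  exact: (cell_rel (before_refl B') (@before_trans _ _ B') a_cell').
rewrite (bigD1 (Ordinal l_lt)) //= (bigD1 B) //= a_cell.
rewrite big1 ?addr0 => [|B' /andP[B'_osp B'_neq]]; last first.
  case: ifP => // /cell_inj eB; case/eqP: B'_neq; exact: before_inj.
rewrite big1 ?addr0 => [|l' l'_neq]; last first.
  rewrite big1 // => B' B'_osp; case: ifP => // /cell_inj eB.
  case/eqP: l'_neq; apply/val_inj => /=; apply/eqP; rewrite eqn_leq.
  by rewrite (before_inj_size B'_osp B_osp eB) (before_inj_size B_osp B'_osp (esym eB)).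
exact: tutte_term_cell.
Qed.

End GenericSum.

(** * The change of variables *)

Section ChangeOfVariables.
Variable n : nat.
Implicit Types (I J K : {set 'I_n}).

Definition toggle (x : 'I_n) J := if x \in J then J :\ x else x |: J.

Lemma in_toggle x J i : (i \in toggle x J) = (i \in J) (+) (i == x).
Proof.
rewrite /toggle; case: (boolP (x \in J)) => xJ; rewrite !inE; case: eqP => [->|_] /=.
- by rewrite xJ.
- by rewrite addbF.
- by rewrite (negbTE xJ).
by rewrite addbF.
Qed.

Lemma toggleK x : involutive (toggle x).
Proof. by move=> J; apply/setP => i; rewrite !in_toggle -addbA addbb addbF. Qed.

Lemma sign_toggle x J K : x \in K ->
  (-1) ^+ (#|toggle x J :&: K| + 1) = - (-1) ^+ (#|J :&: K| + 1) :> rat.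
Proof.
move=> xK; rewrite !addn1 (cardsD1 x) [in RHS](cardsD1 x) !inE in_toggle eqxx xK !andbT.
have -> : toggle x J :&: K :\ x = J :&: K :\ x.
  by apply/setP => i; rewrite !inE in_toggle; case: eqP => //= _; rewrite addbF.
by case: (x \in J); rewrite /= ?add0n ?add1n !exprS ?mulN1r ?opprK.
Qed.

Lemma toggle_cancel (Q : pred {set 'I_n}) x K : x \in K ->
  (forall J, Q (toggle x J) = Q J) ->
  \sum_(J | Q J) (-1) ^+ (#|J :&: K| + 1) = 0 :> rat.
Proof.
move=> xK Q_toggle; set S := \sum_(J | Q J) _.
suff SE : S = - S by lra.
rewrite {1}/S (reindex_inj (inv_inj (toggleK x))) -sumrN.
by apply: eq_big => [J|J _]; [apply: Q_toggle | apply: sign_toggle].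
Qed.

(** Toggling an element of K in J reverses the sign.  An element of K outside I
    can be toggled without changing the condition on J; if K is a proper subset of
    I every J covering the complement of K meets I, so any element will do.  When
    K = I, the complement of I is the only J missing from a sum that cancels. *)
Lemma inclusion_exclusion I K : I != set0 -> K != set0 ->
  \sum_(J | (J :&: I != set0) && (K :|: J == setT)) (-1) ^+ (#|J :&: K| + 1) =
  (K == I)%:R :> rat.
Proof.
move=> I0 /set0Pn[k kK].
have union_toggle x J : x \in K -> (K :|: toggle x J == setT) = (K :|: J == setT).
  move=> xK; congr (_ == _); apply/setP => i; rewrite !inE in_toggle.
  by case: (i =P x) => [->|_]; rewrite ?xK ?addbF.
have all0 : \sum_(J | K :|: J == setT) (-1) ^+ (#|J :&: K| + 1) = 0 :> rat.
  by apply: (toggle_cancel kK) => J; apply: union_toggle.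
case: (eqVneq K I) => [eKI|neKI].
  subst K; move: all0; rewrite (bigID (fun J => J :&: I != set0)) /= => all0.
  rewrite (eq_bigl (fun J => (I :|: J == setT) && (J :&: I != set0))) => [|J]; last exact: andbC.
  move: all0; rewrite [X in _ + X](big_pred1 (~: I)) => [|J].
    by rewrite setIC setICr cards0 expr1 => /eqP; rewrite subr_eq0 => /eqP.
  rewrite negbK /= setI_eq0 disjoints_subset [RHS]eqEsubset.
  apply/andP/andP => -[].
    move=> /eqP IJ J_sub; split=> //; apply/subsetP => i; rewrite inE => /negbTE iI.
    by have := in_setT i; rewrite -IJ inE iI.
  by move=> J_sub sub_J; split=> //; rewrite -subTset -(setUCr I) setUS.
case: (boolP (K \subset I)) => KI; last first.
  have /subsetPn[x xK xI] := KI; apply: (toggle_cancel xK) => J.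
  rewrite union_toggle //; congr (_ && _); congr (_ != _); apply/setP => i.
  by rewrite !inE in_toggle; case: (i =P x) => [->|_]; rewrite ?(negbTE xI) ?andbF ?addbF.
rewrite (eq_bigl (fun J => K :|: J == setT)) // => J.
have /subsetPn[i iI iK] : ~~ (I \subset K).
  by apply: contra neKI => IK; rewrite eqEsubset KI.
case: (K :|: J =P setT) => [KJ|]; last by rewrite andbF.
rewrite andbT; apply/set0Pn; exists i; rewrite inE iI andbT.
by have := in_setT i; rewrite -KJ inE (negbTE iK).
Qed.

Lemma sum_neset (P : pred {set 'I_n}) (F : {set 'I_n} -> rat) :
  (forall J, P J -> J != set0) ->
  \sum_(J | P J) F J = \sum_(J : neset n | P (val J)) F (val J).
Proof.
move=> P0; rewrite (reindex_omap (val : neset n -> {set 'I_n}) insub) => [|J /P0 J0].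
  by apply: eq_bigl => J; rewrite valK eqxx andbT.
by rewrite insubT.
Qed.

Lemma change_of_variables (z : neset n -> rat) (I : neset n) :
  \sum_(J : neset n | val J :&: val I != set0) \sum_(K : neset n | val K :|: val J == setT)
    (-1) ^+ (#|val J :&: val K| + 1) * z K = z I.
Proof.
rewrite (exchange_big_dep xpredT) //=.
have coef (K : neset n) : \sum_(J : neset n | (val J :&: val I != set0) && (val K :|: val J == setT))
    (-1) ^+ (#|val J :&: val K| + 1) = (K == I)%:R :> rat.
  rewrite -(sum_neset (P := fun J => (J :&: val I != set0) && (val K :|: J == setT))
    (fun J => (-1) ^+ (#|J :&: val K| + 1))) => [|J /andP[+ _]].
    by rewrite inclusion_exclusion ?(valP I) ?(valP K).
  by apply: contraNneq => ->; rewrite set0I.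
under eq_bigr => K _ do rewrite -big_distrl /= coef.
rewrite (bigD1 I) //= eqxx mul1r [X in _ + X]big1 ?addr0 // => K /negbTE->.
by rewrite mul0r.
Qed.

End ChangeOfVariables.

(** * The universal Tutte polynomial *)

Lemma count_points_eq n (f f' : {set 'I_n} -> int) (r r' : rel 'I_n) :
  (forall a, cell f r a = cell f' r' a) ->
  count (cell f r) (points f) = count (cell f' r') (points f').
Proof.
move=> cellE; have [f_uniq fE] := pointsP f; have [f'_uniq f'E] := pointsP f'.
rewrite -!size_filter; apply/perm_size/uniq_perm; rewrite ?filter_uniq // => a.
rewrite !mem_filter fE f'E cellE; apply/andP/andP => -[a_cell _]; split=> //.
  by case/andP: a_cell.
by move: a_cell; rewrite -cellE => /andP[].
Qed.

Lemma tutte_var_eval n (w : 'I_#|{: tutte_var n}| -> nat) :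
  exists x y (t : neset n -> nat), (forall J, (0 < t J)%N) /\
    forall p : tutte_ring n, p.@[fun i => (w i).+1%:R] = p.@[eval_at x y (fun J => (t J)%:R)].
Proof.
pose v (a : tutte_var n) : rat := (w (enum_rank a)).+1%:R.
exists (v (inl 0)), (v (inl 1)), (fun J => (w (enum_rank (inr J : tutte_var n))).+1).
split=> // p; apply: meval_eq => i; rewrite -[i in LHS]enum_valK /eval_at /v.
case: (enum_val i) => [k|//]; case: eqP => [-> //|k0].
suff -> : k = 1 by [].
by apply/val_inj; case: k k0 => -[|[]] // k_lt []; apply/val_inj.
Qed.

Theorem theorem7p3 (n : nat) (n_gt0 : (0 < n)%N)
    (T : tutte_ring n) (T_universal : universal_tutte T) :
  let That := set_subst (@z_of_t n) T in
  That =
    (xvar n + yvar n - 1) *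
    (\sum_(l < n.+1) \sum_(B : l.-tuple {set 'I_n} | ord_set_partition B)
        (-1) ^+ (l - 1) * dragon (block_param B (@svar n)) *
        xvar n ^+ (lr_min B - 1) * yvar n ^+ (rl_min B - 1)) /\
  set_subst (@t_of_z n) That = T.
Proof.
move=> That; split; apply/eqP; rewrite -subr_eq0; apply/eqP; apply: mpoly_nat_eq0 => w;
  rewrite mevalB; apply/eqP; rewrite subr_eq0; apply/eqP;
  have [x [y [t [t_gt0 evalE]]]] := tutte_var_eval w; rewrite !{}evalE; last first.
  rewrite !meval_set_subst; apply: meval_eq => i; rewrite /eval_at.
  case: (enum_val i) => // I; rewrite -/(eval_at x y _) /z_of_t rmorph_sum /=.
  rewrite -[RHS](change_of_variables (fun J => (t J)%:R)); apply: eq_bigr => J _.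
  rewrite meval_svar rmorph_sum; apply: eq_bigr => K _.
  by rewrite rmorphM /= rmorphXn rmorphN1 meval_svar.
rewrite meval_universal // (tutte_generic n_gt0) // rmorphM rmorphB rmorphD rmorph1 /=.
rewrite meval_xvar meval_yvar; congr (_ * _); rewrite rmorph_sum; apply: eq_bigr => l _ /=.
rewrite rmorph_sum; apply: eq_bigr => B B_osp /=.
rewrite !rmorphM !rmorphXn rmorphN1 /= meval_xvar meval_yvar meval_dragon -!mulrA.
rewrite [RHS]mulrA; congr (_ * _).
have l_gt0 : (0 < l)%N by apply: leq_ltn_trans (block_index_lt B_osp (Ordinal n_gt0)).
rewrite (count_points_eq (cell_face B_osp t_gt0)).
(* The interior points of the face are counted by its Tutte polynomial at (0, 0). *)
pose u : neset n -> nat := block_param B t.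
have := tutte00 (block_index_lt B_osp) (@block_index_surj _ _ _ B_osp)
  (block_param_supp B_osp (t := t)) (block_param_full B_osp t_gt0).
rewrite -(meval_universal _ _ _ T_universal) (tutte_zero_dragon n_gt0 T_universal) => dragonE.
have -> : dragon (fun J => (block_param B (@svar n) J).@[eval_at x y (fun J => (t J)%:R)] : rat^o) =
    dragon (fun J => (u J)%:R : rat^o).
  congr dragon; apply/funext => J; rewrite /u /block_param; case: pickP => [k _|_]; last by rewrite rmorph0.
  by rewrite rmorph_sum natr_sum; apply: eq_bigr => K _; rewrite /= meval_svar.
rewrite -[RHS]opprK -mulrN [X in _ * X]dragonE -[(-1) ^+ l *+ _]mulr_natr mulrA -exprD.
rewrite (_ : (l - 1 + l = (l - 1).*2.+1)%N); last by lia.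
by rewrite exprS -mul2n exprM sqrrN !expr1n mulr1 mulN1r opprK.
Qed.
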